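(* The function $$g=\frac{f}{\prod_{i<j}^N(x_i^2-x_j^2)^{\frac1r}\prod_{i=1}^Nx_i^{\frac12-\frac sr}}$$ is locally $L^2$-integrable on $\mathbb{R}^N$ provided that one of the following sets of conditions holds: (i) $f\in I_{r-1}^{\pm}$, $2\le r\le N$, $r\in\mathbb{Z}$, $s\ge r-1$, $s\in\mathbb{R}$; (ii) $f\in J_s$, $0\le s\le N-1$, $s\in\mathbb{Z}$, $r\ge N+1$, $r\in\mathbb{R}$; (iii) $f\in\mathbb{C}[x_1,\dots,x_N]$, $s>N-1$, $s\in\mathbb{R}$, $r\ge N+1$, $r\in\mathbb{R}$; (iv) $f\in\mathbb{C}[x_1,\dots,x_N]$, $r<0$, $s<0$, $r,s\in\mathbb{R}$.
   Context: A function $\Psi$ on $\mathbb{R}^N$ is locally $L^2$-integrable if every point has a neighbourhood $U$ with $\int_U|\Psi|^2dx<\infty$. Real powers are understood through absolute values (only $|\Psi|$ matters). For $1\le k\le N-1$, $I_k^\pm\subset\mathbb{C}[x_1,\dots,x_N]$ is the ideal of polynomials vanishing on all planes $\varepsilon_{i_1}x_{i_1}=\varepsilon_{i_2}x_{i_2}=\dots=\varepsilon_{i_{k+1}}x_{i_{k+1}}$, where $\varepsilon_{i_j}=\pm1$ and $1\le i_1<\dots<i_{k+1}\le N$. For $0\le k\le N-1$, $J_k\subset\mathbb{C}[x_1,\dots,x_N]$ is the ideal of polynomials vanishing on all planes $x_{i_1}=\dots=x_{i_{k+1}}=0$ with $1\le i_1<\dots<i_{k+1}\le N$. *)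

(* Defs.v *)
From HB Require Import structures.
From mathcomp Require Import all_boot all_order all_algebra.
From mathcomp Require Import all_classical all_reals all_analysis.
From mathcomp Require Import complex.
From mathcomp Require mpoly.

Set Implicit Arguments.
Unset Strict Implicit.
Unset Printing Implicit Defensive.

Import Order.TTheory GRing.Theory Num.Theory.
Import numFieldNormedType.Exports.

Local Open Scope classical_set_scope.
Local Open Scope ring_scope.
Local Open Scope complex_scope.

(* multinomials' own notations cannot be imported together with those of
   mathcomp-analysis *)
Notation "{ 'mpoly' T [ n ] }" := (mpoly.mpoly n T) : type_scope.

Section measurable_rV.
Context {R : realType} (n : nat).

Definition rV_coord (i : 'I_n) (x : 'rV[R]_n) : measurableTypeR R := x ord0 i.

Definition rV_display : measure_display.
Proof. exact: default_measure_display. Qed.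

Let rV_set0 : g_sigma_preimage rV_coord set0.
Proof. exact: sigma_algebra0. Qed.

Let rV_setC A : g_sigma_preimage rV_coord A -> g_sigma_preimage rV_coord (~` A).
Proof. exact: sigma_algebraC. Qed.

Let rV_bigcup (F : _^nat) : (forall i, g_sigma_preimage rV_coord (F i)) ->
  g_sigma_preimage rV_coord (\bigcup_i (F i)).
Proof. exact: sigma_algebra_bigcup. Qed.

HB.instance Definition _ := @isMeasurable.Build rV_display
  'rV[R]_n (g_sigma_preimage rV_coord) rV_set0 rV_setC rV_bigcup.

End measurable_rV.

Lemma measurable_rV_coord (R : realType) n (i : 'I_n) :
  measurable_fun [set: 'rV[R]_n] (@rV_coord R n i).
Proof.
move=> _ Y mY; rewrite setTI; apply: sub_sigma_algebra => /=.
rewrite -bigcup_seq/=; exists i => /=; first by rewrite mem_index_enum.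
by exists Y => //; rewrite setTI.
Qed.

Lemma measurable_fun_rVP d (T : measurableType d) (R : realType) n
    (f : T -> 'rV[R]_n) :
  (forall i, measurable_fun [set: T] (@rV_coord R n i \o f)) ->
  measurable_fun [set: T] f.
Proof.
move=> mf _ A mA.
have : g_sigma_preimage (fun i => @rV_coord R n i \o f) `<=` measurable.
  apply: smallest_sub; first exact: sigma_algebra_measurable.
  case: n => [|n] in f mf A mA *; first by rewrite big_ord0.
  rewrite -bigcup_mkord_ord; apply: bigcup_sub => i Ii.
  by move=> B [C mC <-]; exact: mf.
by rewrite g_sigma_preimage_comp; apply; exists A.
Qed.

Definition rV_cons (R : realType) n (p : measurableTypeR R * 'rV[R]_n) :
    'rV[R]_n.+1 :=
  \row_(i < n.+1) oapp (fun j => p.2 ord0 j) p.1 (unlift ord0 i).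

Lemma measurable_rV_cons (R : realType) n : measurable_fun setT (@rV_cons R n).
Proof.
apply: measurable_fun_rVP => i.
case: (unliftP ord0 i) => [j|] ->.
- rewrite (_ : _ \o _ = @rV_coord R n j \o snd).
    apply: measurableT_comp; first exact: measurable_rV_coord.
    exact: measurable_snd.
  by apply/funext => p; rewrite /rV_coord /= mxE liftK.
- rewrite (_ : _ \o _ = fst); first exact: measurable_fst.
  by apply/funext => p; rewrite /rV_coord /= mxE unlift_none.
Qed.

Definition rV_uncons (R : realType) n (x : 'rV[R]_n.+1) :
    measurableTypeR R * 'rV[R]_n :=
  (x ord0 ord0, \row_(j < n) x ord0 (lift ord0 j)).

Lemma rV_consK (R : realType) n : cancel (@rV_cons R n) (@rV_uncons R n).
Proof.
move=> [a y]; rewrite /rV_uncons /rV_cons !mxE unlift_none/=; congr pair.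
by apply/rowP => j; rewrite !mxE liftK.
Qed.

Lemma measurable_rV_uncons (R : realType) n :
  measurable_fun setT (@rV_uncons R n).
Proof.
apply/measurable_fun_pairP; split; first exact: (@measurable_rV_coord R _ ord0).
apply: measurable_fun_rVP => j.
rewrite (_ : _ \o _ = @rV_coord R n.+1 (lift ord0 j)).
  exact: measurable_rV_coord.
by apply/funext => x; rewrite /rV_coord /= mxE.
Qed.

Section lebesgue_step.
Local Open Scope ereal_scope.
Context {R : realType} {n : nat}.
Variable m : {sigma_finite_measure set 'rV[R]_n -> \bar R}.

Definition lebesgue_step : set 'rV[R]_n.+1 -> \bar R :=
  pushforward (@lebesgue_measure R \x m) (@rV_cons R n).

Let mpre A : measurable A -> measurable (@rV_cons R n @^-1` A).
Proof.
by move=> mA; rewrite -[X in measurable X]setTI; exact: measurable_rV_cons.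
Qed.

Let step0 : lebesgue_step set0 = 0.
Proof. by rewrite /lebesgue_step /pushforward preimage_set0 measure0. Qed.

Let step_ge0 A : 0 <= lebesgue_step A.
Proof. by rewrite /lebesgue_step /pushforward; exact: measure_ge0. Qed.

Let step_sigma_additive : semi_sigma_additive lebesgue_step.
Proof.
move=> F mF tF mUF; rewrite /lebesgue_step /pushforward preimage_bigcup.
apply: measure_semi_sigma_additive; first by move=> k; exact: mpre.
- apply/trivIsetP => /= i j _ _ ij; rewrite -preimage_setI.
  by move/trivIsetP : tF => /(_ _ _ _ _ ij) ->//; rewrite preimage_set0.
- by rewrite -preimage_bigcup; exact: mpre.
Qed.

HB.instance Definition _ := isMeasure.Build _ _ _ lebesgue_step
  step0 step_ge0 step_sigma_additive.

Let step_sigma_finite : sigma_finite setT lebesgue_step.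
Proof.
have /sigma_finiteP[F [FT ndF Foo]] := sigma_finiteT (@lebesgue_measure R).
have /sigma_finiteP[G [GT ndG Goo]] := sigma_finiteT m.
exists (fun k => @rV_uncons R n @^-1` (F k `*` G k)).
  apply/seteqP; split => // x _.
  have [k _ Fk] : (\bigcup_k F k) (rV_uncons x).1 by rewrite -FT.
  have [l _ Gl] : (\bigcup_l G l) (rV_uncons x).2 by rewrite -GT.
  exists (maxn k l) => //; split.
  - by move: Fk; exact/subsetPset/ndF/leq_maxl.
  - by move: Gl; exact/subsetPset/ndG/leq_maxr.
move=> k; have [mF Fkoo] := Foo k; have [mG Gkoo] := Goo k; split.
  rewrite -[X in measurable X]setTI; apply: measurable_rV_uncons => //.
  exact: measurableX.
rewrite /lebesgue_step /pushforward (_ : _ @^-1` _ = F k `*` G k).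
  by rewrite product_measure1E// lte_mul_pinfty// ge0_fin_numE.
by apply/seteqP; split => p; rewrite /preimage /mkset rV_consK.
Qed.

HB.instance Definition _ := Measure_isSigmaFinite.Build _ _ _ lebesgue_step
  step_sigma_finite.

End lebesgue_step.

(* Lebesgue measure on R^n, as the n-fold product of that on R; see
   [lebesgue_rV_box] for its values on boxes *)
Fixpoint lebesgue_rV (R : realType) (n : nat) :
    {sigma_finite_measure set 'rV[R]_n -> \bar R} :=
  if n is n'.+1 then lebesgue_step (lebesgue_rV R n') else \d_(0 : 'rV[R]_0).

Lemma lebesgue_rV_box (R : realType) n (A : 'I_n -> set (measurableTypeR R)) :
  (forall i, measurable (A i)) ->
  lebesgue_rV R n [set x : 'rV[R]_n | forall i, A i (x ord0 i)] =
  (\prod_(i < n) (lebesgue_measure (A i) : \bar R))%E.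
Proof.
elim: n A => [|n IH] A mA.
  rewrite big_ord0 /= diracE mem_set//=.
  by case.
rewrite big_ord_recl /= /lebesgue_step /pushforward.
rewrite (_ : _ @^-1` _ =
  A ord0 `*` [set x : 'rV[R]_n | forall i, A (lift ord0 i) (x ord0 i)]).
  rewrite product_measure1E//; first by congr *%E; exact: IH.
  rewrite (_ : mkset _ = \bigcap_(i in [set: 'I_n])
      ([set: 'rV[R]_n] `&` @rV_coord R n i @^-1` A (lift ord0 i))).
    apply: fin_bigcap_measurable => // i _.
    exact: measurable_rV_coord.
  apply/seteqP; split => [x Ax i _|x Ax i]; first by split => //; exact: Ax.
  by have [] := Ax i I.
apply/seteqP; split => [[a y]|[a y] [Aa Ay]] /=.
  move=> Aay; split => [|i]/=.
    by have := Aay ord0; rewrite mxE unlift_none.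
  by have := Aay (lift ord0 i); rewrite mxE liftK.
move=> i; rewrite mxE; case: (unliftP ord0 i) => [j|] -> /=.
  exact: Ay.
exact: Aa.
Qed.

Lemma open_measurable_rV (R : realType) n (U : set 'rV[R]_n) :
  open U -> measurable U.
Proof.
move=> oU.
pose box (q : {ffun 'I_n -> rat * rat}) : set 'rV[R]_n :=
  [set x : 'rV[R]_n | forall i,
    `]ratr (q i).1, ratr (q i).2[%classic (x ord0 i)].
have mbox q : measurable (box q).
  rewrite (_ : box q = \bigcap_(i in [set: 'I_n]) ([set: 'rV[R]_n] `&`
      @rV_coord R n i @^-1` `]ratr (q i).1, ratr (q i).2[%classic)).
    apply: fin_bigcap_measurable => // i _.
    by apply: measurable_rV_coord => //; exact: measurable_itv.
  apply/seteqP; split => [x qx i _|x qx i]; first by split => //; exact: qx.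
  by have [] := qx i I.
rewrite (_ : U = \bigcup_(q in [set q | box q `<=` U]) box q).
  rewrite bigcup_mkcond; apply: countable_bigcupT_measurable => // q.
  by case: ifP.
apply/seteqP; split => [x Ux|x [q qU /qU//]].
have [P xP PU] : nbhs x U by exact: open_nbhs_nbhs.
have /choice[q qP] : forall i, exists q : rat * rat,
    ratr q.1 < x ord0 i < ratr q.2 /\
    `]ratr q.1, ratr q.2[%classic `<=` P ord0 i.
  move=> i; have /nbhs_ballP[e /= e0 eP] := xP ord0 i.
  have xe : x ord0 i - e < x ord0 i by rewrite ltrBlDr ltrDl.
  have ex : x ord0 i < x ord0 i + e by rewrite ltrDl.
  have [a] := rat_in_itvoo xe; rewrite in_itv/= => /andP[ea ax].
  have [b] := rat_in_itvoo ex; rewrite in_itv/= => /andP[xb be].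
  exists (a, b); split; first by rewrite ax xb.
  move=> y /=; rewrite in_itv/= => /andP[ay yb]; apply: eP.
  rewrite /ball/= ltr_distlC; apply/andP; split.
    exact: lt_trans ay.
  exact: lt_trans be.
exists [ffun i => q i] => /=.
  move=> y qy; apply: PU => j i; rewrite ord1.
  by apply: (qP i).2; have := qy i; rewrite ffunE.
by move=> i; rewrite ffunE /= in_itv/=; exact: (qP i).1.
Qed.

(* [integrable] includes the measurability of |Psi|^2 on the open set U *)
Definition locally_L2 (R : realType) (N : nat) (Psi : 'rV[R]_N -> R[i]) : Prop :=
  forall x : 'rV[R]_N, exists U : set 'rV[R]_N,
    [/\ open U, U x &
      (lebesgue_rV R N).-integrable U (fun y => (Normc.normc (Psi y) ^+ 2)%:E)].

(* points of C^N, not only of R^N *)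
Definition mpoly_vanish_on (R : realType) (N : nat) (Z : set ('I_N -> R[i])) :
    set {mpoly R[i][N]} :=
  [set f | forall z, Z z -> mpoly.meval z f = 0].

(* S = {i_1 < ... < i_{k+1}}, and (-1) ^+ e i is the sign of x_i *)
Definition ideal_Ipm (R : realType) (N k : nat) : set {mpoly R[i][N]} :=
  mpoly_vanish_on [set z | exists (S : {set 'I_N}) (e : 'I_N -> bool),
    #|S| = k.+1 /\ {in S &, forall i j, (-1) ^+ e i * z i = (-1) ^+ e j * z j}].

Definition ideal_J (R : realType) (N k : nat) : set {mpoly R[i][N]} :=
  mpoly_vanish_on [set z | exists S : {set 'I_N},
    #|S| = k.+1 /\ {in S, forall i, z i = 0}].

(* The denominator is the product of the absolute values of the real powers,
   so that only |g| is meaningful. On its zero set, a negligible union of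
   hyperplanes, g takes conventional values (x / 0 = 0). *)
Definition g_fun (R : realType) (N : nat) (f : {mpoly R[i][N]}) (r s : R)
    (x : 'rV[R]_N) : R[i] :=
  mpoly.meval (fun i => (x ord0 i)%:C) f /
  ((\prod_(i < N) \prod_(j < N | (i < j)%N)
       `|x ord0 i ^+ 2 - x ord0 j ^+ 2| `^ (1 / r)) *
   (\prod_(i < N) `|x ord0 i| `^ (1 / 2 - s / r)))%:C.

(* Main.v *)
(* Let 0 = y_0 < y_1 < ... < y_N be the sorted absolute values of the
   coordinates of a generic point, and d_l = y_(l+1) - y_l the gaps. For each
   order and choice of signs f is a polynomial in the gaps. If m is one of its
   monomials, then the degree of m in a run d_a, ..., d_(b-1) of consecutive
   gaps is at least the order of vanishing of f on the flat where these gaps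
   vanish. The leading form of f along this flat is a nonzero polynomial in the
   points of the cluster which still vanishes on the given planes; merging c of
   these points, where c + 1 equal points make it vanish, and taking the top
   coefficient in the merged variable bounds its degree from below by induction.
   (For f in J_s, each of its monomials contains all but s of the points.)

   Replacing the distance of two points by the largest gap between them, these
   degree bounds show that |g|^2 is at most a constant times the product of the
   d_l^(eps - 1), for some eps > 0. Deleting the coordinates one by one, this
   product is bounded by a sum of products over i of
   ||x_i| - |x_j(i)||^(eps - 1), with j(i) > i or x_j(i) replaced by 0, and
   these are integrated by Tonelli's theorem. *)

Require Import Defs.
From HB Require Import structures.
From mathcomp Require Import all_boot all_order all_algebra.
From mathcomp Require Import all_classical all_reals all_analysis.
From mathcomp Require Import measurable_realfun complex.
From mathcomp Require mpoly.
From mathcomp Require Import ring lra zify.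

Import -(notations) mpoly.
Import Order.TTheory GRing.Theory Num.Theory.
Import numFieldNormedType.Exports.
Local Open Scope classical_set_scope.
Local Open Scope ring_scope.
Local Open Scope complex_scope.

(** * Degree bounds for polynomials vanishing on coordinate flats *)

Lemma poly_eval0 (K : numDomainType) (p : {poly K}) :
  (forall t, p.[t] = 0) -> p = 0.
Proof.
move=> p0; apply/eqP/negPn/negP => pN0.
have := max_poly_roots (p := p) (rs := [seq k%:R | k <- iota 0 (size p)]) pN0.
rewrite size_map size_iota ltnn => H; suff : false by [].
apply: H; first by apply/allP => x _; apply/eqP.
rewrite map_inj_uniq ?iota_uniq//.
by move=> i j /eqP; rewrite eqr_nat => /eqP.
Qed.

Definition weight {n} (T : {set 'I_n}) (m : multinom n) : nat :=
  \sum_(i in T) m i.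

Definition hpart {n} {K : numFieldType} (T : {set 'I_n}) (j : nat)
    (p : {mpoly K[n]}) : {mpoly K[n]} :=
  \sum_(m <- msupp p | weight T m == j)
     mcoeff m p *: mpolyX K m.

Definition scale_on {n} {K : numFieldType} (T : {set 'I_n}) (t : K)
    (z : 'I_n -> K) (i : 'I_n) :=
  if i \in T then t * z i else z i.

Section hpart.
Context {n : nat} {K : numFieldType}.
Implicit Types (T : {set 'I_n}) (p : {mpoly K[n]}).

Lemma prod_scale_on T t (z : 'I_n -> K) (m : multinom n) :
  \prod_i scale_on T t z i ^+ m i = t ^+ weight T m * \prod_i z i ^+ m i.
Proof.
rewrite /weight expr_sum (bigID (mem T)) /= [X in _ = _ * X](bigID (mem T)) /= mulrA.
congr (_ * _).
  by rewrite -big_split /=; apply: eq_bigr => i iT; rewrite /scale_on iT exprMn.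
by apply: eq_bigr => i /negbTE iT; rewrite /scale_on iT.
Qed.

Lemma meval_hpart T j p (z : 'I_n -> K) : meval z (hpart T j p) =
  \sum_(m <- msupp p | weight T m == j)
     mcoeff m p * \prod_i z i ^+ m i.
Proof.
rewrite /hpart raddf_sum /=; apply: eq_bigr => m _.
by rewrite mevalZ mevalX.
Qed.

Lemma weight_lt T p m : m \in msupp p -> (weight T m < msize p)%N.
Proof.
move=> /msize_mdeg_lt; apply: leq_ltn_trans.
by rewrite mdegE /weight [X in (_ <= X)%N](bigID (mem T)) /= leq_addr.
Qed.

(** Along this scaling the coefficient of t^j is the part of degree j in the variables of T, so
    identities valid for all t can be compared coefficient by coefficient. *)
Lemma meval_scale_on T p t (z : 'I_n -> K) :
  meval (scale_on T t z) p =
  (\poly_(j < msize p) meval z (hpart T j p)).[t].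
Proof.
rewrite horner_poly mevalE.
under eq_bigr do rewrite prod_scale_on.
transitivity (\sum_(m <- msupp p) \sum_(i < msize p | i == weight T m :> nat)
  mcoeff m p * (\prod_i z i ^+ m i) * t ^+ i).
  rewrite big_seq [RHS]big_seq; apply: eq_bigr => m mp.
  rewrite (big_pred1 (Ordinal (weight_lt T _ _ mp))) /=; first by rewrite mulrCA mulrC.
  by [].
rewrite (exchange_big_dep xpredT) //=; apply: eq_bigr => i _.
rewrite meval_hpart mulr_suml; apply: eq_bigl => m.
by rewrite eq_sym.
Qed.

Lemma hpart_ge T j p : (msize p <= j)%N -> hpart T j p = 0.
Proof.
move=> pj; rewrite /hpart big_seq_cond big_pred0// => m.
apply/negbTE/negP => /andP[/(weight_lt T) mp /eqP mj].
by move: mp; rewrite mj ltnNge pj.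
Qed.

Lemma hpart_vanish T p (z : 'I_n -> K) :
  (forall t, meval (scale_on T t z) p = 0) ->
  forall j, meval z (hpart T j p) = 0.
Proof.
move=> H j; have [jp|pj] := ltnP j (msize p); last first.
  by rewrite hpart_ge// meval0.
have /poly_eval0/polyP/(_ j) : forall t,
   (\poly_(j < msize p) meval z (hpart T j p)).[t] = 0.
  by move=> t; rewrite -meval_scale_on.
by rewrite coef_poly jp coef0.
Qed.

Lemma hpart_homog T j p t (z : 'I_n -> K) :
  meval (scale_on T t z) (hpart T j p) = t ^+ j * meval z (hpart T j p).
Proof.
rewrite !meval_hpart mulr_sumr; apply: eq_bigr => m /eqP <-.
by rewrite prod_scale_on mulrCA.
Qed.

Lemma mcoeff_hpart T j p m : mcoeff m (hpart T j p) =
  if weight T m == j then mcoeff m p else 0.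
Proof.
rewrite /hpart raddf_sum /=.
under eq_bigr do rewrite mcoeffZ mcoeffX.
have [mp|mp] := boolP (m \in msupp p); last first.
  rewrite (memN_msupp_eq0 mp) if_same big_seq_cond big1// => m'.
  case: (m' =P m) => [->|_]; last by rewrite mulr0.
  by rewrite (negbTE mp).
rewrite big_mkcond (bigD1_seq m)//= ?msupp_uniq// eqxx mulr1 big1 ?addr0//.
by move=> m' /negbTE ->; rewrite mulr0 if_same.
Qed.

Lemma hpart_neq0 T p m : m \in msupp p -> hpart T (weight T m) p != 0.
Proof.
move=> mp; apply/eqP => /(congr1 (mcoeff m)).
rewrite mcoeff_hpart eqxx mcoeff0 => /eqP.
by rewrite mcoeff_eq0 mp.
Qed.

End hpart.

(** Uniqueness of digits in base B, read off modulo B from the lowest one; it keeps distinct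
    monomials distinct under the substitution in [meval_eq0]. *)
Lemma digits_inj n B (a b : 'I_n -> nat) :
  (forall i, a i < B)%N -> (forall i, b i < B)%N ->
  (\sum_(i < n) a i * B ^ i = \sum_(i < n) b i * B ^ i)%N -> a =1 b.
Proof.
elim: n a b => [|n IH] a b aB bB; first by move=> _ [].
rewrite !big_ord_recl /= !expn0 !muln1.
have E (c : 'I_n.+1 -> nat) : (\sum_(i < n) c (lift ord0 i) * B ^ bump 0 i =
    (\sum_(i < n) c (lift ord0 i) * B ^ i) * B)%N.
  rewrite big_distrl /=; apply: eq_bigr => i _.
  by rewrite /bump /= add1n expnSr mulnA.
rewrite !E => ab.
have a0 : a ord0 = b ord0.
  by have := congr1 (modn^~ B) ab; rewrite ![(_ ord0 + _)%N]addnC !modnMDl !modn_small.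
have : (\sum_(i < n) a (lift ord0 i) * B ^ i = \sum_(i < n) b (lift ord0 i) * B ^ i)%N.
  have B0 : (0 < B)%N by exact: leq_trans (aB ord0).
  move: ab; rewrite a0 => /addnI /eqP; rewrite eqn_pmul2r// => /eqP//.
move=> /(IH _ _ (fun i => aB _) (fun i => bB _)) ab' i.
by have [j|] := unliftP ord0 i => ->.
Qed.

(* Kronecker substitution [z_i = t ^ (B ^ i)] with [B] larger than all exponents. *)
Lemma meval_eq0 n (K : numFieldType) (p : {mpoly K[n]}) :
  (forall z, meval z p = 0) -> p = 0.
Proof.
move=> p0; apply/mpolyP => m0; rewrite mcoeff0.
have [mp|/memN_msupp_eq0//] := boolP (m0 \in msupp p).
pose B := msize p.
have mB m : m \in msupp p -> forall i, (m i < B)%N.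
  move=> /msize_mdeg_lt + i; apply: leq_ltn_trans.
  by rewrite mdegE (bigD1 i)//= leq_addr.
pose kr (m : multinom n) := (\sum_(i < n) m i * B ^ i)%N.
have : \sum_(m <- msupp p) mcoeff m p *: 'X^(kr m) = 0 :> {poly K}.
  apply: poly_eval0 => t; rewrite -(p0 (fun i => t ^+ (B ^ i))) mevalE.
  rewrite horner_sum; apply: eq_bigr => m _.
  rewrite hornerZ hornerXn /kr expr_sum; congr (_ * _).
  by apply: eq_bigr => i _; rewrite mulnC exprM.
move=> /(congr1 (fun q : {poly K} => q`_(kr m0))).
rewrite coef0 coef_sum (bigD1_seq m0)//= ?msupp_uniq// coefZ coefXn eqxx mulr1.
rewrite big_seq_cond big1 ?addr0// => m /andP[mp' mm0].
rewrite coefZ coefXn; case: eqP => [E|]; last by rewrite mulr0.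
have /mnmP mE := digits_inj _ _ _ _ (mB _ mp) (mB _ mp') E.
by rewrite mE eqxx in mm0.
Qed.

Lemma meval_neq0 n (K : numFieldType) (p : {mpoly K[n]}) :
  p != 0 -> exists z, meval z p != 0.
Proof.
move=> p0; apply: contrapT => H; move/eqP: p0; apply; apply: meval_eq0 => z.
by apply/eqP/negPn/negP => pz; apply: H; exists z.
Qed.

(** The factor [t ^+ L] cannot be cancelled at t = 0. The identity is therefore read in K[t], where
    ['X^L] is regular and a nonzero value of q rules out D < L. *)
Lemma homog_shift n (K : numFieldType) (q : {mpoly K[n]}) (T : {set 'I_n}) L D :
  q != 0 ->
  (forall t z, t ^+ L * meval (scale_on T t z) q = t ^+ D * meval z q) ->
  (L <= D)%N /\
  forall t z, meval (scale_on T t z) q = t ^+ (D - L) * meval z q.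
Proof.
move=> q0 qLD.
pose A z := \poly_(j < msize q) meval z (hpart T j q).
have AE z : 'X^L * A z = meval z q *: 'X^D.
  apply/eqP; rewrite -subr_eq0; apply/eqP; apply: poly_eval0 => t.
  rewrite hornerD hornerN hornerM hornerZ !hornerXn -meval_scale_on qLD.
  by rewrite mulrC subrr.
have LD : (L <= D)%N.
  have [z qz] := meval_neq0 _ _ _ q0.
  rewrite leqNgt; apply/negP => DL.
  have /(congr1 (fun r : {poly K} => r`_D)) := AE z.
  rewrite coefXnM DL coefZ coefXn eqxx mulr1 => /esym/eqP.
  exact/negP.
split => // t z.
rewrite meval_scale_on -/(A z).
have -> : A z = meval z q *: 'X^(D - L).
  have X0 : 'X^L != 0 :> {poly K} by rewrite monic_neq0// monicXn.
  by apply: (mulfI X0); rewrite AE -scalerAr -exprD subnKC.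
by rewrite hornerZ hornerXn mulrC.
Qed.

Section equal_coord_degree.
Context {n : nat} {K : numFieldType}.

Let X (i : 'I_n) : {mpoly K[n]} := mpolyX K (mnm1 i).

(** The product G of the coordinates and of their pairwise sums and differences is nonzero at (1,
    ..., n), so [q * G] is a nonzero polynomial. *)
Lemma generic_point (q : {mpoly K[n]}) : q != 0 ->
  exists z, [/\ meval z q != 0, forall i, z i != 0 &
    forall i j, i != j -> z i != z j /\ z i != - z j].
Proof.
move=> q0.
pose G := (\prod_i X i) * \prod_i \prod_(j | i != j) ((X i - X j) * (X i + X j)).
have GE z : meval z G =
    (\prod_i z i) * \prod_i \prod_(j | i != j) ((z i - z j) * (z i + z j)).
  rewrite /G mevalM !rmorph_prod /=; congr (_ * _).
    by apply: eq_bigr => i _; rewrite mevalXU.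
  apply: eq_bigr => i _; rewrite rmorph_prod; apply: eq_bigr => j _ /=.
  by rewrite mevalM mevalB mevalD !mevalXU.
have G0 : G != 0.
  apply/eqP => /(congr1 (meval (fun i : 'I_n => i.+1%:R))).
  rewrite GE meval0; apply/eqP; rewrite mulf_neq0//.
    by apply/prodf_neq0 => i _; rewrite pnatr_eq0.
  apply/prodf_neq0 => i _; apply/prodf_neq0 => j ij.
  rewrite mulf_neq0 ?subr_eq0 ?eqr_nat ?eqSS -?natrD ?pnatr_eq0//.
have [z] : exists z, meval z (q * G) != 0 by apply: meval_neq0; rewrite mulf_neq0.
rewrite mevalM mulf_eq0 negb_or => /andP[qz]; rewrite GE mulf_eq0 negb_or.
move=> /andP[/prodf_neq0 z0 /prodf_neq0 zz]; exists z; split => //.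
  by move=> i; exact: z0.
move=> i j ij; have /prodf_neq0/(_ j ij) := zz i isT.
by rewrite mulf_eq0 negb_or subr_eq0 addr_eq0 => /andP.
Qed.

Let sg (b : bool) (e : 'I_n -> bool) i : K := (-1) ^+ (b && e i).

Let sgK b e i : sg b e i * sg b e i = 1.
Proof. by rewrite /sg -exprD addnn -mul2n exprM sqrrN !expr1n. Qed.

(** When a set S of c points is merged into a common value y, the polynomial acquires the root y =
    z_j for each j in T outside S, and also y = - z_j if b holds. Its degree in y is thus at least
    (1 + b) |T \ S|, and these contributions add up as S is removed from T. The flag b tells whether
    points coincide up to sign, as near the origin, or exactly. *)
Lemma equal_coord_degree (b : bool) c (T : {set 'I_n}) D (p : {mpoly K[n]}) :
  p != 0 ->
  (forall t z, meval (scale_on T t z) p = t ^+ D * meval z p) ->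
  (forall (S : {set 'I_n}) (e : 'I_n -> bool) z, S \subset T -> #|S| = c.+1 ->
    {in S &, forall i j, (-1) ^+ (b && e i) * z i = (-1) ^+ (b && e j) * z j} ->
    meval z p = 0) ->
  (b.+1 * (#|T| * #|T|) <= 2 * (c * D) + b.+1 * (c * #|T|))%N.
Proof.
elim: c T D p => [|c IHc] T D p.
  move=> p0 _ pV; have [->|[i iT]] := set_0Vmem T; first by rewrite cards0 !muln0.
  have [z pz] := meval_neq0 _ _ _ p0.
  exfalso; move/eqP: pz; apply; have := pV [set i]%SET (fun=> false) z.
  rewrite ?finset.sub1set ?cards1; apply=> //.
  by move=> j k /set1P -> /set1P ->.
have [k] := ubnP #|T|; elim: k T D p => // k IHk T D p Tk p0 pD pV.
have [Tc|Tc] := leqP #|T| c.+1.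
  by apply: leq_trans (leq_addl _ _); rewrite leq_mul2l leq_mul2r Tc orbT.
(* If p already vanishes when one point fewer coincides, the bound for the smaller c is stronger.
   Otherwise some S of c.+1 points can be merged with p remaining nonzero. *)
have [pV'|] := pselect (forall (S : {set 'I_n}) (e : 'I_n -> bool) z,
    S \subset T -> #|S| = c.+1 ->
    {in S &, forall i j, sg b e i * z i = sg b e j * z j} -> meval z p = 0).
  have := IHc _ _ _ p0 pD pV'.
  move=> /leq_trans; apply; nia.
move=> /existsNP[S] /existsNP[e] /existsNP[z0] /not_implyP[ST] /not_implyP[Sc].
move=> /not_implyP[Se] /eqP pz0.
have [i0 i0S] : exists i0, i0 \in S by apply/card_gt0P; rewrite Sc.
(* Each coordinate in S becomes plus or minus a common value y. [P z] is p as a polynomial in y; its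
   coefficients [q l] are free of the coordinates in S, and L below is its degree for generic z. *)
pose u z i := if i \in S then sg b e i else z i.
pose q l := comp_mpoly [tuple (if i \in S then mpolyC n (sg b e i) else X i) | i < n]
  (hpart S l p).
have qE z l : meval z (q l) = meval (u z) (hpart S l p).
  rewrite /q comp_mpoly_meval; apply: meval_eq => i.
  by rewrite tnth_mktuple /u; case: ifP => _; rewrite ?mevalC ?mevalXU.
pose P z := \poly_(l < msize p) meval z (q l).
have PE z y : (P z).[y] = meval (scale_on S y (u z)) p.
  rewrite meval_scale_on; congr (_.[_]); apply/polyP => l.
  by rewrite !coef_poly qE.
have [L [Lp qL qmax]] : exists L, [/\ (L < msize p)%N, q L != 0 &
    forall l, (L < l)%N -> (l < msize p)%N -> q l = 0].
  have ex : exists l, (l < msize p)%N && (q l != 0).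
    apply: contrapT => H; move/eqP: pz0; apply.
    rewrite (_ : meval z0 p = (P z0).[sg b e i0 * z0 i0]).
      rewrite /P (_ : \poly_(_ < _) _ = 0) ?horner0//.
      apply/polyP => l; rewrite coef_poly coef0; case: ifP => // lp.
      have [->|ql] := eqVneq (q l) 0; first by rewrite meval0.
      by case: H; exists l; rewrite lp.
    rewrite PE; apply: meval_eq => i; rewrite /scale_on /u.
    by case: (boolP (i \in S)) => // iS; rewrite (Se i0 i)// mulrAC sgK mul1r.
  have ub l : (l < msize p)%N && (q l != 0) -> (l <= msize p)%N.
    by move=> /andP[/ltnW].
  case: (ex_maxnP ex ub) => L /andP[Lp qL] Lmax; exists L; split => // l Ll lp.
  apply/eqP; apply: contraTT Ll => ql.
  by rewrite -leqNgt; apply: Lmax; rewrite lp.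
pose T' := T :\: S.
have T'E : (#|T'| + c.+1 = #|T|)%N.
  by rewrite -(cardsID S T) (finset.setIidPr ST) Sc addnC.
have T'P i : i \in T' -> i \in T /\ i \notin S by rewrite inE => /andP[].
have LT : (b.+1 * #|T'| <= L)%N.
  have [z [qz z0' zz]] := generic_point _ qL.
  have Pz : P z != 0.
    apply/eqP => /(congr1 (fun r : {poly K} => r`_L)).
    by rewrite coef_poly Lp coef0 => /eqP; exact/negP.
  have sP : (size (P z) <= L.+1)%N.
    apply/leq_sizeP => l Ll; rewrite coef_poly; case: ifP => // lp.
    by rewrite qmax// meval0.
  (* At this value of y the point j joins S, so that c.+2 coordinates agree up to the allowed
     signs. *)
  have rP (s : bool) j : s ==> b -> j \in T' -> (P z).[(-1) ^+ s * z j] = 0.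
    move=> sb jT'; have [jT jS] := T'P _ jT'; rewrite PE.
    apply: (pV (j |: S) (fun i => if i \in S then e i else s)).
    - by rewrite finset.subUset finset.sub1set jT.
    - by rewrite cardsU1 jS Sc.
    have E i : i \in j |: S -> (-1) ^+ (b && (if i \in S then e i else s)) *
        scale_on S ((-1) ^+ s * z j) (u z) i = (-1) ^+ s * z j.
      rewrite /scale_on /u => /setU1P[->|iS].
        by rewrite (negbTE jS); case: (s) sb => [/= ->|_]; rewrite ?andbF.
      by rewrite iS mulrCA -/(sg b e i) sgK mulr1.
    by move=> i l iS lS; rewrite !E.
  pose rs := [seq z i | i <- enum T'] ++
             (if b then [seq - z i | i <- enum T'] else [::]).
  have rsz : size rs = (b.+1 * #|T'|)%N.
    rewrite size_cat size_map -cardE; case: (b); last by rewrite addn0 mul1n.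
    by rewrite size_map -cardE mul2n addnn.
  rewrite -ltnS -rsz; apply: leq_trans sP; apply: max_poly_roots => //.
    rewrite all_cat; apply/andP; split.
      rewrite all_map; apply/allP => i; rewrite mem_enum /= => iT.
      by have := rP false i isT iT; rewrite mul1r => /rootP.
    case: ifP => // bT; rewrite all_map; apply/allP => i; rewrite mem_enum /= => iT.
    by have := rP true i bT iT; rewrite mulN1r => /rootP.
  have zi : injective z.
    move=> i j zij; apply/eqP/negPn/negP => ij.
    by have [/eqP] := zz _ _ ij.
  rewrite cat_uniq map_inj_uniq// enum_uniq/=; apply/andP; split.
    case: ifP => // _; apply/hasPn => _ /seq.mapP[i _ ->].
    apply/negP => /seq.mapP[j _ zij].
    have [ij|ij] := eqVneq i j.
      move: zij; rewrite ij => /eqP; rewrite eq_sym -addr_eq0 -mulr2n mulrn_eq0/=.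
      exact/negP.
    have [_ /eqP] : z j != z i /\ z j != - z i by apply: zz; rewrite eq_sym.
    by apply; rewrite zij.
  case: ifP => // _; rewrite map_inj_uniq ?enum_uniq//.
  by move=> i j /oppr_inj /zi.
(* Scaling [T'] and y together by t multiplies p by t^D; the coefficients of y^L are then
   compared. *)
have qhom t z : t ^+ L * meval (scale_on T' t z) (q L) = t ^+ D * meval z (q L).
  have E0 : \poly_(l < msize p) (t ^+ l * meval (scale_on T' t z) (q l)) -
     t ^+ D *: P z = 0.
    apply: poly_eval0 => y; rewrite hornerD hornerN hornerZ PE.
    rewrite -pD (_ : meval _ p = (P (scale_on T' t z)).[t * y]).
      rewrite /P !horner_poly; apply/eqP; rewrite subr_eq0; apply/eqP.
      by apply: eq_bigr => l _; rewrite exprMn; ring.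
    rewrite PE; apply: meval_eq => i; rewrite /scale_on /u !inE.
    case: (boolP (i \in S)) => iS /=; last by [].
    by rewrite (fintype.subsetP ST)// mulrA.
  have /(congr1 (fun r : {poly K} => r`_L)) := E0.
  rewrite coefB coefZ !coef_poly Lp coef0 => /eqP; rewrite subr_eq0 => /eqP.
  by [].
have [LD qhom'] := homog_shift _ _ _ _ _ _ qL qhom.
have T'k : (#|T'| < k)%N by move: Tk; rewrite ltnS -T'E; apply: leq_trans; lia.
have := IHk T' (D - L)%N (q L) T'k qL qhom'.
have qV (S' : {set 'I_n}) (e' : 'I_n -> bool) z : S' \subset T' -> #|S'| = c.+2 ->
    {in S' &, forall i j, (-1) ^+ (b && e' i) * z i = (-1) ^+ (b && e' j) * z j} ->
    meval z (q L) = 0.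
  move=> S'T' S'c S'e.
  have /poly_eval0/(congr1 (fun r : {poly K} => r`_L)) : forall y, (P z).[y] = 0.
    move=> y; rewrite PE; apply: (pV S' e') => //.
      by apply: (fintype.subset_trans S'T'); exact: finset.subsetDl.
    have E i : i \in S' -> scale_on S y (u z) i = z i.
      move=> /(fintype.subsetP S'T') /T'P[_ /negbTE iS].
      by rewrite /scale_on /u iS.
    by move=> i j iS jS; rewrite !E//; exact: S'e.
  by rewrite coef_poly Lp coef0.
(* With t = |T'| and k = c.+1, the induction hypothesis for [q L] and L >= (1 + b) t complete the
   square (1 + b) (t + k)^2, where t + k = |T|. *)
move=> /(_ qV); rewrite -T'E.
nia.
Qed.

End equal_coord_degree.

(** A monomial of p missing s + 1 variables of T would survive on the plane where these vanish. So
    each monomial, whose degree in T is D, contains all but at most s of them. *)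
Lemma zero_coord_degree n (K : numFieldType) s (T : {set 'I_n}) D (p : {mpoly K[n]}) :
  p != 0 ->
  (forall t z, meval (scale_on T t z) p = t ^+ D * meval z p) ->
  (forall (S : {set 'I_n}) z, S \subset T -> #|S| = s.+1 ->
    {in S, forall i, z i = 0} -> meval z p = 0) ->
  (#|T| <= D + s)%N.
Proof.
move=> p0 pD pV.
have [m mp] : exists m, m \in msupp p.
  apply: contrapT => H; move/eqP: p0; apply; apply/mpolyP => m.
  rewrite mcoeff0; apply/eqP/negPn/negP; rewrite -mcoeff_msupp => mp.
  by apply: H; exists m.
have mD : weight T m = D.
  apply/eqP/negPn/negP => mD.
  have [z qz] := meval_neq0 _ _ _ (hpart_neq0 T _ _ mp).
  have : \poly_(j < msize p) meval z (hpart T j p) - meval z p *: 'X^D = 0.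
    apply: poly_eval0 => t; rewrite hornerD hornerN hornerZ hornerXn.
    by rewrite -meval_scale_on pD mulrC subrr.
  move=> /(congr1 (fun r : {poly K} => r`_(weight T m))).
  rewrite coefB coef_poly coefZ coefXn (negbTE mD) mulr0 subr0 coef0 weight_lt//.
  exact/eqP.
pose Z := [set i in T | m i == 0%N]%SET.
have Zs : (#|Z| <= s)%N.
  rewrite leqNgt; apply/negP => sZ.
  pose S := [set i in take s.+1 (enum Z)]%SET.
  have Sc : #|S| = s.+1.
    rewrite cardsE (card_uniqP _) ?take_uniq ?enum_uniq// size_takel//.
    by rewrite -cardE.
  have SZ i : i \in S -> i \in Z.
    by rewrite inE => /mem_take; rewrite mem_enum.
  have mS : weight S m = 0%N.
    by rewrite /weight big1// => i /SZ; rewrite inE => /andP[_ /eqP].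
  have := hpart_neq0 S _ _ mp; rewrite mS => /eqP; apply.
  apply: meval_eq0 => z.
  have : meval (scale_on S 0 z) p = 0.
    apply: (pV S) => //.
      by apply/fintype.subsetP => i /SZ; rewrite inE => /andP[].
    by move=> i iS; rewrite /scale_on iS mul0r.
  rewrite meval_scale_on horner_coef0 coef_poly; case: ifP => // p0'.
  by move: (weight_lt S _ _ mp); rewrite mS p0'.
have TZ : (#|T :\: Z| <= D)%N.
  rewrite -mD /weight (big_setID Z) /=; apply: leq_trans (leq_addl _ _).
  rewrite -sum1_card; apply: leq_sum => i; rewrite !inE => /andP[+ iT].
  by rewrite iT /= lt0n.
have := cardsID Z T.
have := subset_leq_card (finset.subsetIr T Z).
lia.
Qed.

(** * Gap coordinates, and the parts of f along a cluster of points *)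

Section gap_expansion.
Context {N : nat} {K : numFieldType}.
Variables (pos : 'I_N.+1 -> 'I_N.+1) (e : 'I_N.+1 -> bool).

Definition cum (d : 'I_N.+1 -> K) (k : nat) : K := \sum_(l < N.+1 | (l < k)%N) d l.

Lemma cum0 d : cum d 0 = 0.
Proof. by rewrite /cum big_pred0. Qed.

Lemma cumS d k : (k < N.+1)%N -> cum d k.+1 = cum d k + d (inord k).
Proof.
move=> kN; rewrite /cum (bigD1 (inord k)) /= ?inordK// addrC; congr (_ + _).
apply: eq_bigl => l; rewrite ltnS ltn_neqAle andbC; congr (_ && _).
by rewrite -val_eqE /= inordK.
Qed.

(** In the application [pos i] is the rank, counted from 0, of |x_i| among the sorted absolute
    values, [e i] is the sign of x_i, and [cum d k] is y_k; hence the shift by one. *)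
Definition gap_point (d : 'I_N.+1 -> K) (i : 'I_N.+1) : K :=
  (-1) ^+ e i * cum d (pos i).+1.

Let X (i : 'I_N.+1) : {mpoly K[N.+1]} := mpolyX K (mnm1 i).

Definition gap_mpoly (f : {mpoly K[N.+1]}) : {mpoly K[N.+1]} :=
  comp_mpoly
    [tuple ((-1) ^+ e i) *: \sum_(l < N.+1 | (l < (pos i).+1)%N) X l | i < N.+1] f.

Lemma meval_gap_mpoly f d : meval d (gap_mpoly f) = meval (gap_point d) f.
Proof.
rewrite /gap_mpoly comp_mpoly_meval; apply: meval_eq => i.
rewrite tnth_mktuple mevalZ raddf_sum /gap_point /cum /=; congr (_ * _).
by apply: eq_bigr => l _; rewrite mevalXU.
Qed.

(* The leading form of [f] along the flat on which the gaps [a, .., b - 1] vanish;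
   its variables [z] are the points of the cluster, up to a common translation
   if the cluster does not contain the origin. *)
Lemma cluster_form f (m : multinom N.+1) (a b : nat) :
  m \in msupp (gap_mpoly f) -> (a < b <= N.+1)%N ->
  let G := [set l : 'I_N.+1 | (a <= l < b)%N]%SET in
  let T := [set p : 'I_N.+1 | (a.-1 <= p < b)%N]%SET in
  exists phi : {mpoly K[N.+1]}, [/\ phi != 0,
    forall t z, meval (scale_on T t z) phi = t ^+ weight G m * meval z phi &
    forall z, (forall x u t, (a = 0%N -> u = 0) ->
       (forall i, pos i \in T -> x i = (-1) ^+ e i * (u + t * z (pos i))) ->
       meval x f = 0) -> meval z phi = 0].
Proof.
move=> mf /andP[ab bN] G T.
(* The gaps outside the cluster are frozen at their values in a point [d0] where the part of degree
   [weight G m] does not vanish. *)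
have [d0 Fd0] := meval_neq0 _ _ _ (hpart_neq0 G _ _ mf).
set j := weight G m in Fd0 *; set FG := hpart G j _ in Fd0.
(* A gap of the cluster is the difference of a point and the preceding one; the point preceding rank
   0 is the origin. *)
pose Xm (k : nat) : {mpoly K[N.+1]} := if k is k'.+1 then X (inord k') else 0.
pose Zm (z : 'I_N.+1 -> K) (k : nat) : K := if k is k'.+1 then z (inord k') else 0.
pose dl z l := if l \in G then z l - Zm z l else d0 l.
pose phi := comp_mpoly
  [tuple (if l \in G then X l - Xm l else mpolyC N.+1 (d0 l))
  | l < N.+1] FG.
have phiE z : meval z phi = meval (dl z) FG.
  rewrite /phi comp_mpoly_meval; apply: meval_eq => l.
  rewrite tnth_mktuple /dl; case: ifP => _; last by rewrite mevalC.
  rewrite mevalB mevalXU; congr (_ - _).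
  by case: (l : nat) => [|k] /=; rewrite ?meval0 ?mevalXU.
exists phi; split.
(* At the partial sums of [d0] these differences give back [d0]. *)
- apply/eqP => /(congr1 (meval (fun p : 'I_N.+1 => cum d0 p.+1))).
  rewrite phiE meval0 (_ : meval _ FG = meval d0 FG); first exact/eqP.
  apply: meval_eq => l; rewrite /dl; case: ifP => // _.
  have -> : Zm (fun p : 'I_N.+1 => cum d0 p.+1) l = cum d0 l.
    case: l => -[|k] kN /=; first by rewrite cum0.
    by rewrite inordK// ltnW.
  by rewrite cumS// inord_val addrAC subrr add0r.
- move=> t z; rewrite !phiE -hpart_homog; apply: meval_eq => l.
  rewrite /dl /scale_on; case: ifPn => // lG.
  have lT : l \in T.
    by move: lG; rewrite !inE => /andP[al ->]; rewrite andbT (leq_trans _ al)// leq_pred.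
  rewrite lT mulrBr; congr (_ - _).
  case: l lG {lT} => -[|k] kN /=; first by rewrite mulr0.
  have kN' : (k < N.+1)%N by exact: ltnW.
  rewrite !inE /= inordK// => /andP[ak kb].
  by rewrite (_ : (a.-1 <= k < b)%N) //; move: ak kb; clear; lia.
(* It suffices that f vanishes when the gaps of the cluster are scaled by t. The cluster then
   consists of the points u + t z_p, where u = y_a - t z_(a-1) is zero if a = 0. *)
- move=> z zV; rewrite phiE; apply: hpart_vanish => t; rewrite meval_gap_mpoly.
  pose d := scale_on G t (dl z).
  have cumE k : (a <= k)%N -> (k <= b)%N -> cum d k = cum d a + t * (Zm z k - Zm z a).
    elim: k => [|k IH].
      by rewrite leqn0 => /eqP ->; rewrite subrr mulr0 addr0.
    rewrite leq_eqVlt => /predU1P[->|].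
      by rewrite subrr mulr0 addr0.
    rewrite ltnS => ak kb; have kN : (k < N.+1)%N by exact: leq_trans kb bN.
    rewrite cumS// IH// 1?ltnW// -addrA; congr (_ + _).
    have kG : inord k \in G by rewrite inE inordK// ak kb.
    by rewrite /d /scale_on kG /dl kG inordK//= -mulrDr; congr (_ * _); ring.
  apply: (zV _ (cum d a - t * Zm z a) t).
    by move=> ->; rewrite cum0 /= mulr0 subr0.
  move=> i; rewrite inE => /andP[ai ib]; rewrite /gap_point; congr (_ * _).
  rewrite (cumE (pos i).+1)//=; last by move: ai; clear; lia.
  by rewrite inord_val; ring.
Qed.

End gap_expansion.

Section orders.
Context {R : realType} {N : nat}.
Variables (pos : 'I_N.+1 -> 'I_N.+1) (e : 'I_N.+1 -> bool).
Hypothesis pos_inj : injective pos.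
Variable f : {mpoly R[i][N.+1]}.

(** The gaps a, ..., b - 1 join y_a, ..., y_b, of ranks a - 1, ..., b - 1. For a = 0 the point y_0
    is the origin and not a coordinate, which the truncated [a.-1] accounts for. *)
Lemma card_cluster (a b : nat) : (a < b <= N.+1)%N ->
  #|[set p : 'I_N.+1 | (a.-1 <= p < b)%N]%SET| = (b - a.-1)%N.
Proof.
move=> /andP[ab bN].
have -> : (b - a.-1)%N = size (map (fun k => inord k : 'I_N.+1) (index_iota a.-1 b)).
  by rewrite size_map size_iota.
rewrite -(card_uniqP _); last first.
  rewrite map_inj_in_uniq ?iota_uniq// => i j; rewrite !mem_index_iota.
  move=> /andP[_ ib] /andP[_ jb] /(congr1 val) /=.
  by rewrite !inordK//; exact: leq_trans bN.
apply: eq_card => p; rewrite inE; apply/idP/idP.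
  move=> pab; apply/(nthP ord0); exists (p - a.-1)%N.
    by rewrite size_map size_iota; move: pab; clear; lia.
  rewrite (nth_map 0%N) ?size_iota; last by move: pab; clear; lia.
  rewrite nth_iota; last by move: pab; clear; lia.
  by rewrite subnKC ?inord_val//; case/andP: pab.
move=> /(nthP ord0)[k]; rewrite size_map size_iota => kab.
rewrite (nth_map 0%N) ?size_iota// nth_iota// => <-.
by rewrite inordK; move: kab bN; clear; lia.
Qed.

Let card_preim (S : {set 'I_N.+1}) : #|[set i | pos i \in S]%SET| = #|S|.
Proof. by rewrite -(card_preimset S pos_inj); apply: eq_card => i; rewrite !inE. Qed.

(** Coinciding points of the cluster give a plane of the ideal once the signs [e] are undone.
    Additional signs [e'] are allowed only if a = 0, where the translation u vanishes; this is the
    flag of [equal_coord_degree]. *)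
Lemma order_Ipm c (m : multinom N.+1) (a b : nat) :
  @ideal_Ipm R N.+1 c f -> m \in msupp (gap_mpoly pos e f) -> (a < b <= N.+1)%N ->
  ((a == 0%N).+1 * ((b - a.-1) * (b - a.-1)) <=
   2 * (c * weight [set l : 'I_N.+1 | (a <= l < b)%N]%SET m) +
   (a == 0%N).+1 * (c * (b - a.-1)))%N.
Proof.
move=> fI mf ab.
have [phi [phi0 phiD phiV]] := cluster_form _ _ _ _ _ _ mf ab.
rewrite -(card_cluster _ _ ab); apply: (equal_coord_degree _ _ _ _ _ phi0 phiD).
move=> S e' z ST Sc Se'; apply: phiV => x u t u0 xE; apply: fI.
exists [set i | pos i \in S]%SET, (fun i => e i (+) ((a == 0%N) && e' (pos i))).
split; first by rewrite card_preim.
have E i : pos i \in S ->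
    (-1) ^+ (e i (+) ((a == 0%N) && e' (pos i))) * x i =
    u + t * ((-1) ^+ ((a == 0%N) && e' (pos i)) * z (pos i)).
  move=> iS; rewrite xE ?(fintype.subsetP ST)// mulrA -signr_addb.
  rewrite addbAC addbb addFb; case: eqP => [a0|_] /=; last by rewrite !mul1r.
  by rewrite u0// !add0r mulrCA.
move=> i j; rewrite !inE => iS jS; rewrite !E//; congr (_ + _ * _).
exact: Se'.
Qed.

(** In a cluster at the origin u = 0, so zeros of z are zeros of x and [zero_coord_degree]
    applies. *)
Lemma order_J s (m : multinom N.+1) (b : nat) :
  @ideal_J R N.+1 s f -> m \in msupp (gap_mpoly pos e f) -> (0 < b <= N.+1)%N ->
  (b <= weight [set l : 'I_N.+1 | (0 <= l < b)%N]%SET m + s)%N.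
Proof.
move=> fJ mf b0.
have [phi [phi0 phiD phiV]] := cluster_form _ _ _ _ _ _ mf b0.
rewrite -[X in (X <= _)%N]subn0 -(card_cluster _ _ b0).
apply: (zero_coord_degree _ _ _ _ _ _ phi0 phiD).
move=> S z ST Sc Sz; apply: phiV => x u t u0 xE; apply: fJ.
exists [set i | pos i \in S]%SET; split; first by rewrite card_preim.
move=> i; rewrite inE => iS.
by rewrite xE ?(fintype.subsetP ST)// u0// Sz// mulr0 addr0 mulr0.
Qed.

End orders.

(** * Products of powers of distances on the line *)

Section pair_sums.
Context {R : realType}.

Definition pair_sum (a b : nat) (g : nat -> nat -> R) : R :=
  \sum_(a <= q < b) \sum_(a <= p < q.+1) g p q.+1.

Lemma pair_sum_split a k b (g : nat -> nat -> R) : (a <= k < b)%N ->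
  pair_sum a b g = pair_sum a k g + pair_sum k.+1 b g +
    \sum_(k <= q < b) \sum_(a <= p < k.+1) g p q.+1.
Proof.
move=> /andP[ak kb]; rewrite /pair_sum (bigop.big_cat_nat ak (ltnW kb)) /= -addrA.
congr (_ + _).
rewrite [\sum_(k.+1 <= q < b) _](_ : _ =
  \sum_(k <= q < b) \sum_(k.+1 <= p < q.+1) g p q.+1); last first.
  by rewrite [RHS]big_ltn// [X in _ = X + _]big_geq// add0r.
rewrite -big_split /=; apply: eq_big_nat => q /andP[kq qb].
by rewrite (bigop.big_cat_nat (n := k.+1)) 1?addrC//= ltnW.
Qed.

Lemma pair_sum0 a (g : nat -> nat -> R) : pair_sum a a g = 0.
Proof. by rewrite /pair_sum big_geq. Qed.

Lemma mono_seq (y : nat -> R) a b : (forall l, (a <= l < b)%N -> y l < y l.+1) ->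
  forall i j, (a <= i <= j)%N -> (j <= b)%N -> y i <= y j.
Proof.
move=> yi i j /andP[ai ij] jb.
elim: j ij jb => [|j IH]; first by rewrite leqn0 => /eqP ->.
rewrite leq_eqVlt => /predU1P[->//|]; rewrite ltnS => ij jb.
apply: le_trans (IH ij (ltnW jb)) _; apply/ltW/yi.
by rewrite (leq_trans ai ij).
Qed.

Lemma exists_large_gap (y : nat -> R) (a b : nat) : (a < b)%N ->
  exists2 k, (a <= k < b)%N & y b - y a <= (b - a)%:R * (y k.+1 - y k).
Proof.
move=> ab; apply: contrapT => H.
have {}H k : (a <= k < b)%N -> (b - a)%:R * (y k.+1 - y k) < y b - y a.
  by move=> kab; rewrite ltNge; apply/negP => ?; apply: H; exists k.
have : \sum_(a <= k < b) ((b - a)%:R * (y k.+1 - y k)) <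
       \sum_(a <= k < b) (y b - y a).
  rewrite !(big_ltn ab) /=; apply: ltr_leD; first by apply: H; rewrite leqnn.
  rewrite big_seq_cond [leRHS]big_seq_cond; apply: ler_sum => k.
  rewrite mem_index_iota andbT => /andP[ak kb].
  by apply/ltW/H; rewrite kb (ltnW ak).
rewrite -mulr_sumr telescope_sumr 1?ltnW// sumr_const_nat mulr_natl.
by rewrite ltxx.
Qed.

(** The final addition in [log_pair_sum_le]: L is the logarithm of the whole length, ll and lr those
    of the two sides, and ld that of the split gap. *)
Let log_split_arith (pl pr cr al ar ac wl wr wc x z e ll lr L N SL SR ld : R) :
  pl <= N * al + (wl + x * (1 - e)) * ll + (e - 1) * SL ->
  pr <= N * ar + (wr + z * (1 - e)) * lr + (e - 1) * SR ->
  (wl + x * (1 - e)) * ll <= (wl + x * (1 - e)) * L ->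
  (wr + z * (1 - e)) * lr <= (wr + z * (1 - e)) * L ->
  cr <= wc * L + N * ac -> (1 - e) * ld <= (1 - e) * L ->
  pl + pr + cr <= N * (al + ar + ac) +
    (wl + wr + wc + (x + z + 1) * (1 - e)) * L + (e - 1) * (SL + (ld + SR)).
Proof. 
move=> h1 h2 h3 h4 h5 h6.
have := lerD (lerD h1 h2) h5 => h.
apply: (le_trans h); rewrite -subr_ge0.
set lhs := (X in 0 <= X).
have -> : lhs = ((wl + x * (1 - e)) * L - (wl + x * (1 - e)) * ll) +
  ((wr + z * (1 - e)) * L - (wr + z * (1 - e)) * lr) +
  ((1 - e) * L - (1 - e) * ld) by rewrite /lhs; ring.
apply: addr_ge0; first apply: addr_ge0; by rewrite subr_ge0.
Qed.

(* Split at a largest gap: all the pairs that it separates are at distance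
   comparable to [y b - y a]. *)
Lemma log_pair_sum_le (y : nat -> R) (w : nat -> nat -> R) (eps : R) (n a b : nat) :
  eps <= 1 -> (a <= b)%N -> (b - a <= n)%N ->
  (forall l, (a <= l < b)%N -> y l < y l.+1) ->
  (forall i j, (a <= i <= j)%N -> (j <= b)%N ->
     0 <= pair_sum i j w + (j - i)%:R * (1 - eps)) ->
  pair_sum a b (fun p q => w p q * ln (y q - y p)) <=
    ln n%:R * pair_sum a b (fun p q => `|w p q|) +
    (pair_sum a b w + (b - a)%:R * (1 - eps)) * ln (y b - y a) +
    (eps - 1) * \sum_(a <= l < b) ln (y l.+1 - y l).
Proof.
move=> eps1; have [m] := ubnP (b - a).
elim: m a b => // m IH a b bam; rewrite leq_eqVlt => /predU1P[<- _ _ _|ab].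
  by rewrite !pair_sum0 subnn big_geq// !(mulr0n, mulr0, mul0r, addr0).
move=> ban yi W0; set L := y b - y a.
have mono := mono_seq _ _ _ yi.
have [k /andP[ak kb] gapk] := exists_large_gap y _ _ ab.
have n0 : (0 < n)%N by apply: leq_trans ban; rewrite subn_gt0.
have yk : y k < y k.+1 by apply: yi; rewrite ak kb.
have ykL : y k.+1 - y k <= L.
  by apply: lerB; apply: mono; rewrite ?leqnn ?ak ?kb ?(ltnW kb)// (leq_trans ak).
have Lgap : L / n%:R <= y k.+1 - y k.
  rewrite ler_pdivrMr ?ltr0n// mulrC; apply: le_trans gapk _.
  by rewrite ler_wpM2r ?subr_ge0 ?(ltW yk)// ler_nat.
have L0 : 0 < L by apply: lt_le_trans ykL; rewrite subr_gt0.
(* A crossing distance lies between L / n and L, so its logarithm differs from ln L by at most ln n,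
   whatever the sign of [w p q]. *)
have cross_le p q : (a <= p <= k)%N -> (k < q <= b)%N ->
    w p q * ln (y q - y p) <= w p q * ln L + ln n%:R * `|w p q|.
  move=> /andP[ap pk] /andP[kq qb].
  have Dk : y k.+1 - y k <= y q - y p.
    by apply: lerB; apply: mono; rewrite ?ap ?pk ?kq ?qb ?(ltnW kb) ?(leq_trans ak).
  have D0 : 0 < y q - y p by apply: lt_le_trans Dk; rewrite subr_gt0.
  have DL : y q - y p <= L.
    apply: lerB; apply: mono; rewrite ?leqnn ?qb ?ap//=.
      by rewrite (leq_trans ap)// (leq_trans pk)// ltnW.
    by rewrite (leq_trans pk)// ltnW.
  have lDL : ln (y q - y p) <= ln L by rewrite ler_ln.
  have lLD : ln L - ln n%:R <= ln (y q - y p).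
    rewrite -ln_div ?posrE ?ltr0n// ler_ln ?posrE ?divr_gt0 ?ltr0n//.
    exact: le_trans Lgap Dk.
  have [w0|w0] := leP 0 (w p q).
    rewrite ger0_norm// ler_wpDr ?mulr_ge0// ?ln_ge0 ?ler1n//.
    by rewrite ler_wpM2l.
  rewrite ltr0_norm//; apply: (le_trans (ler_wnM2l (ltW w0) lLD)).
    by rewrite mulrBr mulrN [ln n%:R * _]mulrC.
have IHl : pair_sum a k (fun p q => w p q * ln (y q - y p)) <=
    ln n%:R * pair_sum a k (fun p q => `|w p q|) +
    (pair_sum a k w + (k - a)%:R * (1 - eps)) * ln (y k - y a) +
    (eps - 1) * \sum_(a <= l < k) ln (y l.+1 - y l).
  apply: IH => //; [lia|lia| |].
    by move=> l /andP[al lk]; apply: yi; rewrite al (ltn_trans lk).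
  by move=> i j aij jk; apply: W0 => //; rewrite (leq_trans jk)// ltnW.
have IHr : pair_sum k.+1 b (fun p q => w p q * ln (y q - y p)) <=
    ln n%:R * pair_sum k.+1 b (fun p q => `|w p q|) +
    (pair_sum k.+1 b w + (b - k.+1)%:R * (1 - eps)) * ln (y b - y k.+1) +
    (eps - 1) * \sum_(k.+1 <= l < b) ln (y l.+1 - y l).
  apply: IH => //; [lia|lia| |].
    by move=> l /andP[al lk]; apply: yi; rewrite lk (leq_trans _ al)// ltnW.
  move=> i j /andP[ai ij] jk; apply: W0 => //.
  by rewrite ij andbT (leq_trans _ ai)// ltnW.
(* By [W0] the coefficient is nonnegative, so the logarithm may be raised to ln L; an empty side
   contributes 0. *)
have Wl : (pair_sum a k w + (k - a)%:R * (1 - eps)) * ln (y k - y a) <=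
          (pair_sum a k w + (k - a)%:R * (1 - eps)) * ln L.
  move: ak; rewrite leq_eqVlt => /predU1P[<-|ak'].
    by rewrite pair_sum0 subnn !(mulr0n, mul0r, addr0).
  apply: ler_wpM2l; first by apply: W0; rewrite ?leqnn ?(ltnW ak')// ltnW.
  have ya : y a < y k.
    apply: (@lt_le_trans _ _ (y a.+1)); first by apply: yi; rewrite leqnn.
    by apply: mono; move: ak' kb; clear; lia.
  rewrite ler_ln ?posrE// ?subr_gt0// /L lerD2r; apply: mono; move: ak' kb; clear; lia.
have Wr : (pair_sum k.+1 b w + (b - k.+1)%:R * (1 - eps)) * ln (y b - y k.+1) <=
          (pair_sum k.+1 b w + (b - k.+1)%:R * (1 - eps)) * ln L.
  move: (kb); rewrite leq_eqVlt => /predU1P[<-|kb'].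
    by rewrite pair_sum0 subnn !(mulr0n, mul0r, addr0).
  apply: ler_wpM2l; first by apply: W0; rewrite ?leqnn// kb andbT ltnW.
  have yb : y k.+1 < y b.
    apply: (@lt_le_trans _ _ (y k.+2)).
      by apply: yi; rewrite kb' (leq_trans ak)// ltnW.
    by apply: mono; move: ak kb'; clear; lia.
  rewrite ler_ln ?posrE// ?subr_gt0// /L lerD2l lerN2; apply: mono; move: ak kb; clear; lia.
pose cross (g : nat -> nat -> R) := \sum_(k <= q < b) \sum_(a <= p < k.+1) g p q.+1.
have crossE : cross (fun p q => w p q * ln (y q - y p)) <=
    cross w * ln L + ln n%:R * cross (fun p q => `|w p q|).
  rewrite /cross mulr_suml mulr_sumr -big_split /=.
  rewrite big_seq_cond [leRHS]big_seq_cond; apply: ler_sum => q.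
  rewrite mem_index_iota andbT => kqb.
  rewrite mulr_suml mulr_sumr -big_split /=.
  rewrite big_seq_cond [leRHS]big_seq_cond; apply: ler_sum => p.
  by rewrite mem_index_iota andbT ltnS => apk; exact: cross_le.
(* The split gap supplies the unit by which b - a exceeds (k - a) + (b - k.+1). *)
have lnd : (1 - eps) * ln (y k.+1 - y k) <= (1 - eps) * ln L.
  by apply: ler_wpM2l; rewrite ?subr_ge0// ler_ln ?posrE// subr_gt0.
have akb : (a <= k < b)%N by rewrite ak.
rewrite !(pair_sum_split _ _ _ _ akb) -/(cross _) -/(cross _) -/(cross _).
rewrite (bigop.big_cat_nat ak (ltnW kb)) /= [X in (eps - 1) * (_ + X)]big_ltn//=.
have -> : (b - a)%:R = (k - a)%:R + (b - k.+1)%:R + 1 :> R.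
  by rewrite (_ : b - a = k - a + (b - k.+1) + 1)%N ?natrD//; move: ak kb; clear; lia.
exact: log_split_arith IHl IHr Wl Wr crossE lnd.
Qed.

End pair_sums.

(** * Removing points one by one from a product of gaps *)

Section gap_products.
Context {R : realType}.

Fixpoint gap_prod (e x : R) (s : seq R) : R :=
  if s is y :: s' then (y - x) `^ e * gap_prod e y s' else 1.

Lemma gap_prod_ge0 e x s : 0 <= gap_prod e x s.
Proof. by elim: s x => //= y s IH x; rewrite mulr_ge0 ?powR_ge0. Qed.

Lemma ge0_ler_powR_neg (e a b : R) : e <= 0 -> 0 < a -> a <= b -> b `^ e <= a `^ e.
Proof.
move=> e0 a0 ab; rewrite /powR !gt_eqF ?(lt_le_trans a0)// ler_expR.
by rewrite ler_wnM2l// ler_ln ?posrE ?(lt_le_trans a0).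
Qed.

(** The larger of the two gaps is at least half of y - x, and e <= 0; the power of the smaller one
    is a summand on the right. *)
Lemma powR_gap_split e (x z y : R) : e <= 0 -> x < z -> z < y ->
  (z - x) `^ e * (y - z) `^ e <=
  2 `^ (- e) * (`|z - x| `^ e + `|z - y| `^ e) * (y - x) `^ e.
Proof.
move=> e0 xz zy; rewrite (distrC z y) !gtr0_norm ?subr_gt0//.
have zx0 : 0 < z - x by rewrite subr_gt0.
have yz0 : 0 < y - z by rewrite subr_gt0.
have yx0 : 0 < y - x by rewrite subr_gt0 (lt_trans xz).
have half a : (y - x) / 2 <= a -> a `^ e <= 2 `^ (- e) * (y - x) `^ e.
  move=> ha; apply: (le_trans (ge0_ler_powR_neg _ _ _ e0 _ ha)).
    by rewrite divr_gt0.
  rewrite powRM ?invr_ge0 ?(ltW yx0)// mulrC ler_wpM2r ?powR_ge0//.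
  by rewrite -powR_inv1// -powRrM mulN1r.
have [h|h] := leP ((y - x) / 2) (y - z).
  apply: (@le_trans _ _ ((z - x) `^ e * (2 `^ (- e) * (y - x) `^ e))).
    by rewrite ler_wpM2l ?powR_ge0 ?half.
  rewrite mulrCA -!mulrA ler_wpM2l ?powR_ge0// ler_wpM2r ?powR_ge0//.
  by rewrite lerDl powR_ge0.
apply: (@le_trans _ _ ((2 `^ (- e) * (y - x) `^ e) * (y - z) `^ e)).
  by rewrite ler_wpM2r ?powR_ge0 ?half//; lra.
rewrite -!mulrA ler_wpM2l ?powR_ge0// mulrC ler_wpM2r ?powR_ge0//.
by rewrite lerDr powR_ge0.
Qed.

(** Removing z merges its two neighbouring gaps, which [powR_gap_split] controls. Summing over all
    remaining points, and not only the neighbours, makes the bound independent of the order. *)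
Lemma gap_prod_rem e x s z : e <= 0 -> path <%R x s -> z \in s ->
  gap_prod e x s <= 2 `^ (- e) * (\sum_(w <- x :: rem z s) `|z - w| `^ e) *
    gap_prod e x (rem z s).
Proof.
move=> e0; have two1 : 1 <= 2 `^ (- e) :> R.
  by rewrite -[leLHS](powRr0 2) ler_powR ?ler1n ?oppr_ge0.
elim: s x => //= y s IH x /andP[xy ys]; rewrite inE => /predU1P[->|zs].
  rewrite eqxx; case: s ys {IH} => /= [_|y' s /andP[yy' _]].
    rewrite big_seq1 !mulr1 gtr0_norm ?subr_gt0//.
    by rewrite ler_peMl ?powR_ge0.
  rewrite mulrA [leRHS]mulrA ler_wpM2r ?gap_prod_ge0//.
  apply: (le_trans (powR_gap_split _ _ _ _ e0 xy yy')).
  rewrite ler_wpM2r ?powR_ge0// ler_wpM2l ?powR_ge0// !big_cons addrA lerDl.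
  by apply: sumr_ge0 => w _; exact: powR_ge0.
case: eqP => [yz|_].
  have /allP/(_ _ zs) := order_path_min lt_trans ys.
  by rewrite yz ltxx.
rewrite /= mulrCA ler_wpM2l ?powR_ge0//; apply: (le_trans (IH _ ys zs)).
rewrite ler_wpM2r ?gap_prod_ge0// ler_wpM2l ?powR_ge0//.
by rewrite [leRHS]big_cons lerDr powR_ge0.
Qed.

Local Open Scope ereal_scope.

Variable kap : R -> \bar R.
Hypothesis kap_ge0 : forall t, 0 <= kap t.

(** Expanded, a sum over trees rooted at 0 in which the parent of each entry is a later entry or 0.
    The first entry occurs in one factor only and can be integrated out first. *)
Fixpoint tree_sum (v : seq R) : \bar R :=
  if v is z :: v' then (\sum_(w <- 0%R :: v') kap (z - w)%R) * tree_sum v' else 1.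

Lemma tree_sum_ge0 v : 0 <= tree_sum v.
Proof. by elim: v => //= z v IH; rewrite mule_ge0 ?sume_ge0. Qed.

(** Points leave the sorted list in the order of v, not by size, so one and the same bound serves
    all orderings of the coordinates. *)
Lemma gap_prod_le_tree_sum (e M c : R) (v : seq R) : (e <= 0)%R -> (0 <= c)%R ->
  (forall t, (0 < `|t| <= M)%R -> (`|t| `^ e)%:E <= c%:E * kap t) ->
  uniq v -> (forall z, z \in v -> (0 < z <= M)%R) ->
  (gap_prod e 0 (sort <=%R v))%:E <=
    ((2 `^ (- e) * c) ^+ size v)%:E * tree_sum v.
Proof.
move=> e0 c0 kapc; elim: v => [|z v IH] /=; first by rewrite expr0 mule1.
move=> /andP[zv uv] vM.
have zM := vM z (mem_head _ _).
have {}vM w : w \in v -> (0 < w <= M)%R by move=> wv; apply: vM; rewrite inE wv orbT.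
have remE : rem z (sort <=%R (z :: v)) = sort <=%R v.
  apply: (sorted_eq le_trans le_anti).
  - exact: (subseq_sorted le_trans (rem_subseq _ _) (sort_le_sorted _)).
  - exact: sort_le_sorted.
  have zS : z \in sort <=%R (z :: v) by rewrite mem_sort mem_head.
  have : perm_eq (z :: rem z (sort <=%R (z :: v))) (z :: v).
    by rewrite -(permPl (perm_to_rem zS)) perm_sort.
  by rewrite perm_cons => h; rewrite perm_sym perm_sort perm_sym.
have srt : path <%R 0%R (sort <=%R (z :: v)).
  rewrite path_min_sorted.
    by rewrite sort_lt_sorted /= zv.
  apply/allP => w; rewrite mem_sort inE => /predU1P[->|wv].
    by case/andP: zM.
  by case/andP: (vM _ wv).
have zs : z \in sort <=%R (z :: v) by rewrite mem_sort mem_head.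
have := gap_prod_rem e _ _ _ e0 srt zs; rewrite remE => H.
have perm0 : perm_eq (0%R :: sort <=%R v) (0%R :: v).
  by rewrite perm_cons perm_sort.
rewrite (perm_big _ perm0) /= in H.
have vIH := IH uv vM.
have zw w : w \in 0%R :: v -> (0 < `|z - w| <= M)%R.
  case/andP: zM => z0 zM; rewrite inE => /predU1P[->|wv].
    by rewrite subr0 gtr0_norm// z0.
  case/andP: (vM _ wv) => w0 wM; rewrite normr_gt0 subr_eq0; apply/andP; split.
    by apply: contraNneq zv => ->.
  by rewrite ler_norml; apply/andP; split; lra.
have sumE : (\sum_(w <- 0%R :: v) `|z - w| `^ e)%:E <=
    c%:E * \sum_(w <- 0%R :: v) kap (z - w)%R.
  rewrite -sumEFin ge0_sume_distrr//.
  by rewrite big_seq [leRHS]big_seq; apply: lee_sum => w /zw; exact: kapc.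
apply: (le_trans (y := (2 `^ (- e))%:E * (c%:E * \sum_(w <- 0%R :: v) kap (z - w)%R) *
   (((2 `^ (- e) * c) ^+ size v)%:E * tree_sum v))).
  apply: (le_trans (y := _%:E)); first by rewrite lee_fin; exact: H.
  rewrite !EFinM; apply: lee_pmul => //.
  - by rewrite lee_fin mulr_ge0 ?powR_ge0// sumr_ge0// => w _; exact: powR_ge0.
  - by rewrite lee_fin gap_prod_ge0.
  - by apply: lee_wpmul2l => //; rewrite lee_fin powR_ge0.
by rewrite exprS !EFinM [X in X * _ <= _]muleA muleACA.
Qed.
End gap_products.

(** * An integrable kernel *)

Section dyadic_kernel.
Local Open Scope ereal_scope.
Context {R : realType}.
Variables (M eps : R).
Hypotheses (M0 : (0 < M)%R) (eps0 : (0 < eps)%R) (eps1 : (eps <= 1)%R).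

Let q : R := 2 `^ (1 - eps).

Let q1 : (1 <= q)%R.
Proof. by rewrite /q -[leLHS](powRr0 2) ler_powR ?ler1n ?subr_ge0. Qed.

Let q0 : (0 < q)%R. Proof. exact: lt_le_trans q1. Qed.

Let q2 : (q / 2 < 1)%R.
Proof.
rewrite ltr_pdivrMr// mul1r /q -[ltRHS]powRr1// /powR pnatr_eq0 /= ltr_expR.
by rewrite ltr_pM2r ?ln_gt0 ?ltr1n// gtrBl.
Qed.

Definition dyadic_ball (k : nat) : set R := [set t : R | (`|t| <= M / 2 ^+ k)%R].

(* A multiple of [`|t| `^ (eps - 1)] on [[-M, M]], but infinite at 0, so that
   the points where the bounds degenerate need no separate treatment. *)
Definition dyadic_kernel (t : R) : \bar R :=
  \sum_(0 <= k <oo) (q ^+ k * \1_(dyadic_ball k) t)%:E.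

Let term_ge0 k t : 0 <= (q ^+ k * \1_(dyadic_ball k) t)%:E.
Proof. by rewrite lee_fin mulr_ge0 ?exprn_ge0 ?(ltW q0). Qed.

Lemma dyadic_kernel_ge0 t : 0 <= dyadic_kernel t.
Proof. by apply: nneseries_ge0 => k _ _; exact: term_ge0. Qed.

Lemma dyadic_kernel0 : dyadic_kernel 0%R = +oo.
Proof.
apply/eqyP => A A0.
have [n An] : exists n : nat, (A <= n%:R)%R.
  by exists (Num.truncn A).+1; exact/ltW/truncnS_gt.
apply: (le_trans (y := \sum_(0 <= k < n) (q ^+ k * \1_(dyadic_ball k) 0%R)%:E)).
  apply: (le_trans (y := (\sum_(0 <= k < n) 1%R)%:E)).
    by rewrite lee_fin sumr_const_nat subn0.
  rewrite -sumEFin; apply: lee_sum => k _; rewrite lee_fin indicE mem_set.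
    by rewrite mulr1 exprn_ege1.
  by rewrite /dyadic_ball/= normr0 divr_ge0 ?(ltW M0)// exprn_ge0.
by apply: nneseries_lim_ge => k _ _; exact: term_ge0.
Qed.

Lemma powR_le_dyadic_kernel t : (0 < `|t| <= M)%R ->
  (`|t| `^ (eps - 1))%:E <= (M `^ (eps - 1) * q)%:E * dyadic_kernel t.
Proof.
move=> /andP[t0 tM].
(* The least ball missing t has index k.+1, so t lies in ball k and the term [q ^+ k] alone
   suffices; bounding |t| below by M / 2^(k+1) costs the factor q in the constant. *)
have ex : exists k, (M / 2 ^+ k < `|t|)%R.
  exists (Num.truncn (M / `|t|)).+1.
  rewrite ltr_pdivrMr ?exprn_gt0// mulrC -ltr_pdivrMr//.
  apply: (lt_le_trans (truncnS_gt _)).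
  by rewrite -natrX ler_nat ltnW// ltn_expl.
case: (ex_minnP ex) => -[|k] kt kmin.
  by move: kt; rewrite expr0 divr1 ltNge tM.
have tk : (`|t| <= M / 2 ^+ k)%R.
  by rewrite leNgt; apply/negP => /kmin; rewrite ltnn.
apply: (le_trans (y := (M `^ (eps - 1) * q)%:E * (q ^+ k)%:E)); last first.
  apply: lee_wpmul2l; first by rewrite lee_fin mulr_ge0 ?powR_ge0 ?(ltW q0).
  apply: (le_trans (y := \sum_(0 <= i < k.+1) (q ^+ i * \1_(dyadic_ball i) t)%:E)).
    rewrite big_nat_recr//= indicE mem_set// mulr1 leeDr//.
    by apply: sume_ge0 => i _; exact: term_ge0.
  by apply: nneseries_lim_ge => i _ _; exact: term_ge0.
rewrite -EFinM lee_fin -mulrA -exprS.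
have h0 : (0 < M / 2 ^+ k.+1)%R by rewrite divr_gt0 ?exprn_gt0.
have -> : (M `^ (eps - 1) * q ^+ k.+1 = (M / 2 ^+ k.+1) `^ (eps - 1))%R.
  rewrite powRM ?(ltW M0) ?invr_ge0 ?exprn_ge0//; congr (_ * _)%R.
  rewrite /q -powR_mulrn ?powR_ge0// -powRrM -[in RHS](powR_mulrn)//.
  by rewrite -powR_inv1 ?powR_ge0// -!powRrM; congr (_ `^ _)%R; ring.
rewrite /powR !gt_eqF// ler_expR ler_wnM2l ?subr_le0//.
by rewrite ler_ln ?posrE// ltW.
Qed.

Let measurable_dyadic_ball k : measurable (dyadic_ball k).
Proof.
rewrite (_ : dyadic_ball k = `[- (M / 2 ^+ k), M / 2 ^+ k]%classic)%R//.
by apply/seteqP; split => t /=; rewrite /dyadic_ball/= in_itv/= ler_norml.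
Qed.

Lemma measurable_dyadic_kernel :
  measurable_fun setT dyadic_kernel.
Proof.
apply: ge0_emeasurable_sum => [k x _ _|k _]; first exact: term_ge0.
apply/measurable_EFinP; exact: measurable_funM.
Qed.

(** The ball of index k pulls back into two intervals, around w and - w, of total length 4 M / 2^k.
    This leaves a geometric series of ratio q / 2 < 1, uniformly in w. *)
Lemma integral_dyadic_kernel (w : R) :
  \int[@lebesgue_measure R]_a dyadic_kernel (`|a| - w)%R <=
  (4 * M / (1 - q / 2))%:E.
Proof.
have mB k : measurable ((fun a : measurableTypeR R => `|a| - w)%R @^-1` dyadic_ball k).
  rewrite -[X in measurable X]setTI.
  have mf : measurable_fun setT (fun a : measurableTypeR R => (`|a| - w)%R).
    exact: measurable_funB.
  by apply: mf => //; exact: measurable_dyadic_ball.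
rewrite /dyadic_kernel integral_nneseries//; last first.
  move=> k; apply/measurable_EFinP; apply: measurable_funM => //.
  rewrite (_ : (fun x => _) =
    \1_((fun a : measurableTypeR R => `|a| - w)%R @^-1` dyadic_ball k)) //.
have Ik k : \int[@lebesgue_measure R]_a (q ^+ k * \1_(dyadic_ball k) (`|a| - w)%R)%:E
    <= (4 * M * (q / 2) ^+ k)%:E.
  under eq_integral do rewrite EFinM.
  rewrite ge0_integralZl_EFin//; last 2 first.
  - rewrite (_ : (fun x => _) =
      EFin \o \1_((fun a : measurableTypeR R => `|a| - w)%R @^-1` dyadic_ball k)) //.
    by apply/measurable_EFinP; exact: (measurable_indic (mB k)).
  - by rewrite exprn_ge0 ?(ltW q0).
  rewrite (_ : (fun x => _) = fun x =>
    (\1_((fun a : measurableTypeR R => `|a| - w)%R @^-1` dyadic_ball k) x)%:E) //.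
  rewrite integral_indic// setIT.
  set d := (M / 2 ^+ k)%R.
  have d0 : (0 <= d)%R by rewrite divr_ge0 ?(ltW M0) ?exprn_ge0.
  have sub : (fun a : measurableTypeR R => `|a| - w)%R @^-1` dyadic_ball k `<=`
      `[(w - d)%R, (w + d)%R]%classic `|` `[(- w - d)%R, (- w + d)%R]%classic.
    move=> a; rewrite /dyadic_ball/= !in_itv/= ler_norml -/d => /andP[h1 h2].
    have [a0|a0] := leP 0%R a.
      by left; move: h1 h2; rewrite ger0_norm// => h1 h2; apply/andP; split; lra.
    by right; move: h1 h2; rewrite ltr0_norm// => h1 h2; apply/andP; split; lra.
  have mI (x : R) : lebesgue_measure `[(x - d)%R, (x + d)%R]%classic <= (2 * d)%:E.
    rewrite lebesgue_measure_itv/= lte_fin; case: ifP => _.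
      by rewrite -EFinD lee_fin; lra.
    by rewrite lee_fin mulr_ge0.
  apply: (le_trans (y := (q ^+ k)%:E * (4 * d)%:E)).
    apply: lee_wpmul2l; first by rewrite lee_fin exprn_ge0 ?(ltW q0).
    apply: (le_trans (le_measure _ _ _ sub)); rewrite ?inE//.
      exact: measurableU.
    apply: (le_trans (measureU2 _ _ _)) => //.
    apply: (le_trans (leeD (mI w) (mI (- w)%R))).
    by rewrite -EFinD lee_fin; lra.
  rewrite -EFinM lee_fin /d expr_div_n le_eqVlt; apply/orP; left; apply/eqP.
  by field; rewrite expf_neq0.
apply: (le_trans (lee_nneseries _ (fun k _ => Ik k))).
  by move=> k _ _; apply: integral_ge0 => x _; exact: term_ge0.
apply: lime_le.
  apply: is_cvg_nneseries => k _ _; rewrite lee_fin.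
  by rewrite mulr_ge0 ?exprn_ge0 ?divr_ge0 ?(ltW q0)// mulr_ge0// ltW.
apply: nearW => n; rewrite sumEFin lee_fin.
have := geometric_le_lim n (mulr_ge0 (ler0n R 4) (ltW M0)) (divr_gt0 q0 (ltr0n R 2)).
apply; rewrite gtr0_norm// divr_gt0//.
Qed.

End dyadic_kernel.

(** * Integration of tree sums by Tonelli's theorem *)

Section integral_tree_sum.
Local Open Scope ereal_scope.
Context {R : realType}.
Variables (kap : R -> \bar R) (K : R).
Hypothesis K0 : (0 <= K)%R.
Hypothesis kap_ge0 : forall t, 0 <= kap t.
Hypothesis mkap : measurable_fun setT kap.
Hypothesis int_kap : forall w,
  \int[@lebesgue_measure R]_a kap (`|a| - w)%R <= K%:E.

Definition abs_seq n (x : 'rV[R]_n) : seq R := [seq `|x ord0 i|%R | i <- enum 'I_n].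

Lemma abs_seq_cons n (a : R) (y : 'rV[R]_n) :
  abs_seq n.+1 (rV_cons (a, y)) = `|a|%R :: abs_seq n y.
Proof.
rewrite /abs_seq enum_ordSl /= /rV_cons mxE unlift_none /=; congr cons.
by rewrite -map_comp; apply: eq_map => i /=; rewrite mxE liftK.
Qed.

Lemma measurable_tree_sum d (T : measurableType d) (fs : seq (T -> R)) :
  {in fs, forall f, measurable_fun setT f} ->
  measurable_fun setT (fun x => tree_sum kap [seq f x | f <- fs]).
Proof.
elim: fs => [|f fs IH] mfs /=; first exact: measurable_cst.
apply: emeasurable_funM; last by apply: IH => g gfs; apply: mfs; rewrite inE gfs orbT.
have mf : measurable_fun setT f by apply: mfs; rewrite mem_head.
under eq_fun do rewrite big_cons big_map.
apply: emeasurable_funD.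
  by apply: measurableT_comp => //; under eq_fun do rewrite subr0.
under eq_fun do rewrite big_seq big_mkcond.
apply: (emeasurable_sum fs
  (h := fun g x => if g \in fs then kap (f x - g x)%R else 0)) => g.
case: (boolP (g \in fs)) => [gfs|_]; last exact: measurable_cst.
apply: measurableT_comp => //; apply: measurable_funB => //.
by apply: mfs; rewrite inE gfs orbT.
Qed.

Lemma measurable_tree_sum_abs_seq n :
  measurable_fun setT (fun x : 'rV[R]_n => tree_sum kap (abs_seq n x)).
Proof.
have -> : (fun x : 'rV[R]_n => tree_sum kap (abs_seq n x)) =
  fun x => tree_sum kap
    [seq f x | f <- [seq (fun x : 'rV[R]_n => `|x ord0 i|%R) | i <- enum 'I_n]].
  by apply/funext => x; rewrite -map_comp.
apply: measurable_tree_sum => f /seq.mapP[i _ ->].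
apply: (measurableT_comp (@normr_measurable R setT)); exact: measurable_rV_coord.
Qed.

(** Only the first factor contains the first coordinate. It has n + 1 terms, each of integral at
    most K. *)
Lemma integral_tree_sum n :
  \int[lebesgue_rV R n]_x tree_sum kap (abs_seq n x) < +oo.
Proof.
elim: n => [|n IH].
  under eq_integral do rewrite /abs_seq enum_ord0 /=.
  by rewrite integral_cst//= mul1e /= diracT ltry.
have mF : measurable_fun setT (fun p : measurableTypeR R * 'rV[R]_n =>
    tree_sum kap (abs_seq n.+1 (rV_cons p))).
  apply: (measurableT_comp (measurable_tree_sum_abs_seq n.+1)).
  exact: measurable_rV_cons.
have mS : measurable_fun setT (fun y : 'rV[R]_n => tree_sum kap (abs_seq n y)).
  exact: measurable_tree_sum_abs_seq.
rewrite /= /lebesgue_step ge0_integral_pushforward//=; last 3 first.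
- exact: measurable_rV_cons.
- exact: measurable_tree_sum_abs_seq.
- by move=> x _; exact: tree_sum_ge0.
rewrite preimage_setT fubini_tonelli2//; last by move=> p; exact: tree_sum_ge0.
have mk w : measurable_fun setT (fun a : measurableTypeR R => kap (`|a| - w)%R).
  by apply: measurableT_comp => //; exact: measurable_funB.
have inner y : \int[@lebesgue_measure R]_a
    tree_sum kap (abs_seq n.+1 (rV_cons (a, y))) <=
    (n.+1%:R * K)%:E * tree_sum kap (abs_seq n y).
  under eq_integral do rewrite abs_seq_cons /=.
  rewrite ge0_integralZr//; last 3 first.
  - by apply: emeasurable_sum => w; exact: mk.
  - by move=> a _; exact: sume_ge0.
  - exact: tree_sum_ge0.
  apply: lee_wpmul2r; first exact: tree_sum_ge0.
  rewrite ge0_integral_sum//.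
  apply: (@le_trans _ _ (\sum_(w <- 0%R :: abs_seq n y) K%:E)).
    by apply: lee_sum => w _; exact: int_kap.
  rewrite sumEFin lee_fin big_const_seq count_predT.
  rewrite (_ : size _ = n.+1) ?iter_addr_0 ?mulr_natl//.
  by rewrite /= size_map size_enum_ord.
apply: (@le_lt_trans _ _ (\int[lebesgue_rV R n]_y
  ((n.+1%:R * K)%:E * tree_sum kap (abs_seq n y)))).
  apply: ge0_le_integral => //.
  - by move=> y _; apply: integral_ge0 => a _; exact: tree_sum_ge0.
  - by apply: measurable_fun_fubini_tonelli_G => // p; exact: tree_sum_ge0.
  - exact: measurable_funeM.
  - by move=> y _; exact: inner.
rewrite ge0_integralZl_EFin//.
- by rewrite lte_mul_pinfty// lee_fin mulr_ge0.
- by move=> y _; exact: tree_sum_ge0.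
- by rewrite mulr_ge0.
Qed.

End integral_tree_sum.

(** * The pointwise bound *)

Section log_weight.
Context {R : realType}.
Variables (r s eps M : R) (n : nat) (alpha : nat -> nat).
Hypotheses (eps1 : eps <= 1) (M0 : 0 < M).
Hypothesis origin_run : forall b, (b <= n)%N ->
  eps * b%:R <= 2 * (\sum_(0 <= l < b) alpha l)%:R + 2 * s / r * b%:R
                - 2 / r * b%:R * (b%:R - 1).
Hypothesis other_run : forall a b, (0 < a <= b)%N -> (b <= n)%N ->
  eps * (b - a)%:R <= 2 * (\sum_(a <= l < b) alpha l)%:R + (b - a)%:R
                - r^-1 * (b - a)%:R * ((b - a)%:R + 1).

(** The coefficient of ln (y q - y p) in the logarithm of the squared quotient of the monomial alpha
    by the denominator, once the q.-1 factors y q + y p with p > 0 are replaced by y q and charged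
    to the pair (0, q). The two hypotheses on runs say that its sum over a run of k gaps, plus k (1
    - eps), is nonnegative. *)
Let w (p q : nat) : R :=
  (if p == 0%N then 2 * s / r - 1 - 2 / r * q.-1%:R else - (2 / r)) +
  (if p.+1 == q then 2 * (alpha p)%:R else 0).

Let inner_w (g : nat -> R) a q : (a <= q)%N ->
  \sum_(a <= p < q.+1) w p q.+1 * g p =
  \sum_(a <= p < q.+1)
    (if p == 0%N then 2 * s / r - 1 - 2 / r * q%:R else - (2 / r)) * g p + 2 * (alpha q)%:R * g q.
Proof.
move=> aq; under eq_bigr do rewrite /w mulrDl.
rewrite big_split /=; congr (_ + _).
rewrite big_nat_recr//= eqxx big_nat_cond big1 ?add0r// => p /andP[/andP[_ pq] _].
by rewrite eqSS (ltn_eqF pq) mul0r.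
Qed.

Let pair_sum_other a b : (0 < a <= b)%N ->
  pair_sum a b w = 2 * (\sum_(a <= l < b) alpha l)%:R
     - r^-1 * (b - a)%:R * ((b - a)%:R + 1).
Proof.
move=> /andP[a0 ab]; rewrite -(subnK ab); move: (b - a)%N => k {ab b}.
rewrite addnK addnC; elim: k => [|k IH].
  by rewrite addn0 pair_sum0 big_geq// !(mulr0n, mulr0, mul0r) subr0.
rewrite addnS /pair_sum big_nat_recr ?leq_addr//= -/(pair_sum a (a + k) w) IH.
rewrite [X in _ = 2 * X%:R - _]big_nat_recr ?leq_addr//=.
rewrite (eq_bigr (fun p => w p (a + k).+1 * 1)); last by move=> p _; rewrite mulr1.
rewrite inner_w ?leq_addr//.
rewrite (eq_big_nat _ _ (F2 := fun=> - (2 / r))); last first.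
  by move=> p /andP[ap _]; rewrite mulr1 gtn_eqF// (leq_trans a0).
rewrite sumr_const_nat subSn ?leq_addr// addKn natrD -mulr_natr.
by rewrite -(natr1 k); ring.
Qed.

Let pair_sum_origin b :
  pair_sum 0 b w = 2 * (\sum_(0 <= l < b) alpha l)%:R
     + (2 * s / r - 1) * b%:R - 2 / r * b%:R * (b%:R - 1).
Proof.
elim: b => [|b IH].
  by rewrite pair_sum0 big_geq// !(mulr0n, mulr0, mul0r) subr0 addr0.
rewrite /pair_sum big_nat_recr//= -/(pair_sum 0 b w) IH.
rewrite [X in _ = 2 * X%:R + _ - _]big_nat_recr//=.
rewrite (eq_bigr (fun p => w p b.+1 * 1)); last by move=> p _; rewrite mulr1.
rewrite inner_w// [\sum_(0 <= p < b.+1) _]big_ltn//=.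
rewrite (eq_big_nat _ _ (F2 := fun=> - (2 / r))); last first.
  by move=> p /andP[p0 _]; rewrite mulr1 gtn_eqF.
rewrite sumr_const_nat subSS subn0 natrD -mulr_natr.
by rewrite -(natr1 b); ring.
Qed.

Lemma log_weight_bound : exists K : R, forall y : nat -> R,
  y 0%N = 0 -> (forall l, (l < n)%N -> y l < y l.+1) -> y n <= M ->
  \sum_(0 <= q < n) (2 * (alpha q)%:R * ln (y q.+1 - y q)
    - (1 - 2 * s / r) * ln (y q.+1)
    - 2 / r * \sum_(1 <= p < q.+1) ln (y q.+1 ^+ 2 - y p ^+ 2)) <=
  K + (eps - 1) * \sum_(0 <= l < n) ln (y l.+1 - y l).
Proof.
have [n0|n0] := posnP n.
  by exists 0 => y _ _ _; rewrite n0 !big_geq// mulr0 addr0.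
pose W := pair_sum 0 n w + (n - 0)%:R * (1 - eps).
have W0 i j : (0 <= i <= j)%N -> (j <= n)%N ->
    0 <= pair_sum i j w + (j - i)%:R * (1 - eps).
  move=> /andP[_ ij] jn; have [i0|i0] := posnP i.
    rewrite i0 pair_sum_origin subn0; have := origin_run j jn.
    set A := (\sum_(0 <= l < j) _)%:R; lra.
  have ai : (0 < i <= j)%N by rewrite i0.
  rewrite pair_sum_other//; have := other_run i j ai jn.
  set A := (\sum_(i <= l < j) _)%:R; lra.
(* The cost of replacing y q + y p, which lies between y q and 2 y q, by y q. *)
pose K1 : R := \sum_(0 <= q < n) \sum_(1 <= p < q.+1) `|2 / r| * ln 2.
exists (K1 + (ln n%:R * pair_sum 0 n (fun p q => `|w p q|) + W * ln M)) => y y0 yi yM.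
have yi' l : (0 <= l < n)%N -> y l < y l.+1 by case/andP=> _; exact: yi.
have mono := mono_seq y 0 n yi'.
have ypos q : (q < n)%N -> 0 < y q.+1.
  move=> qn; apply: (@le_lt_trans _ _ (y q)); last exact: yi.
  by rewrite -y0; apply: mono; rewrite // ltnW.
have yn0 : 0 < y n by rewrite -(prednK n0); apply: ypos; rewrite ltn_predL.
apply: (@le_trans _ _ (K1 + pair_sum 0 n (fun p q => w p q * ln (y q - y p)))); last first.
  rewrite -[leRHS]addrA lerD2l.
  have := log_pair_sum_le y w eps n 0 n eps1 (leq0n n) _ yi' W0.
  rewrite subn0 => /(_ (leqnn n)) /le_trans; apply.
  rewrite lerD2r lerD2l -[n in n%:R * (1 - eps)]subn0 -/W y0 subr0.
  (* W is nonnegative, so ln (y n) may be raised to ln M. *)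
  apply: ler_wpM2l; first exact: W0.
  by rewrite ler_ln.
rewrite /K1 /pair_sum -big_split /=.
rewrite big_nat_cond [leRHS]big_nat_cond; apply: ler_sum => q /andP[/andP[_ qn] _].
rewrite (inner_w (fun p => ln (y q.+1 - y p)))//.
rewrite [\sum_(0 <= p < q.+1) _]big_ltn//= y0 subr0.
rewrite [X in _ <= _ + (_ + X + _)](eq_big_nat _ _
  (F2 := fun p => - (2 / r) * ln (y q.+1 - y p))); last first.
  by move=> p /andP[p0 _]; rewrite gtn_eqF.
have lnE p : (1 <= p < q.+1)%N ->
    - (2 / r) * ln (y q.+1 ^+ 2 - y p ^+ 2) <=
    `|2 / r| * ln 2 + - (2 / r) * ln (y q.+1 - y p) + - (2 / r) * ln (y q.+1).
  move=> /andP[p1 pq]; rewrite subr_sqr.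
  have yp0 : 0 < y p.
    by have := ypos p.-1; rewrite prednK//; apply; move: pq qn; clear; lia.
  have yq0 := ypos _ qn.
  have ypq : y p < y q.+1.
    by apply: le_lt_trans (yi _ qn); apply: mono; rewrite /= ?pq// ltnW.
  rewrite lnM ?posrE ?subr_gt0 ?addr_gt0//.
  have l1 : ln (y q.+1) <= ln (y q.+1 + y p).
    by rewrite ler_ln ?posrE ?addr_gt0// lerDl ltW.
  have l2 : ln (y q.+1 + y p) <= ln 2 + ln (y q.+1).
    rewrite -lnM ?posrE// ler_ln ?posrE ?addr_gt0 ?mulr_gt0//.
    by rewrite mulr_natl mulr2n lerD2l ltW.
  (* For 2 / r >= 0 the lower bound y q for the sum is used, otherwise the upper bound 2 y q. *)
  have [c0|c0] := leP 0 (2 / r).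
    rewrite ger0_norm//.
    have h1 := ler_wpM2l c0 l1.
    have h2 : 0 <= 2 / r * ln 2 by rewrite mulr_ge0// ln_ge0// ler1n.
    by move: h1 h2; rewrite !mulNr !mulrDr; lra.
  rewrite ltr0_norm//.
  have h1 := ler_wnM2l (ltW c0) l2.
  by move: h1; rewrite !mulNr !mulrDr; lra.
have lnC : \sum_(1 <= p < q.+1) (- (2 / r) * ln (y q.+1)) =
  - (2 / r) * ln (y q.+1) * q%:R.
  by rewrite sumr_const_nat subSS subn0 mulr_natr.
have := ler_sum_nat lnE; rewrite !big_split /= lnC -[X in X <= _]mulr_sumr.
lra.
Qed.

End log_weight.

(** * The denominator in terms of the sorted absolute values *)

Section sorted_coordinates.
Context {R : realType}.

Lemma gap_prodE (e x : R) (s : seq R) : path <%R x s ->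
  gap_prod e x s = expR (e * \sum_(0 <= l < size s)
    ln (nth 0 (x :: s) l.+1 - nth 0 (x :: s) l)).
Proof.
elim: s x => [|y s IH] x /=; first by rewrite big_geq// mulr0 expR0.
move=> /andP[xy ys]; rewrite big_nat_recl//= IH// mulrDr expRD; congr (_ * _).
by rewrite /powR gt_eqF// subr_gt0.
Qed.

Lemma sum_ord_pairs n (G : nat -> nat -> R) :
  (forall i j, G i j = G j i) -> (forall i, G i i = 0) ->
  \sum_(i < n) \sum_(j < n) G i j = 2 * \sum_(i < n) \sum_(j < n | (i < j)%N) G i j.
Proof.
move=> Gsym G0.
have -> : \sum_(i < n) \sum_(j < n) G i j =
    \sum_(i < n) (\sum_(j < n | (i < j)%N) G i j + \sum_(j < n | (j < i)%N) G i j).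
  apply: eq_bigr => i _; rewrite (bigID (fun j : 'I_n => (i < j)%N)) /=; congr (_ + _).
  rewrite (bigD1 i) ?ltnn//= G0 add0r; apply: eq_bigl => j.
  by rewrite -leqNgt ltn_neqAle andbC.
rewrite big_split /= mulr_natl mulr2n; congr (_ + _).
rewrite (exchange_big_dep xpredT) //=; apply: eq_bigr => i _.
by apply: eq_bigr => j _; exact: Gsym.
Qed.

Variables (n : nat) (x : 'rV[R]_n).
Let v := abs_seq n x.
Let s := sort <=%R v.
Let y := nth 0 (0 :: s).

Lemma size_abs_seq : size v = n.
Proof. by rewrite size_map size_enum_ord. Qed.

Let size_s : size s = n.
Proof. by rewrite size_sort size_abs_seq. Qed.

Lemma nth_abs_seq (i : 'I_n) : nth 0 v i = `|x ord0 i|.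
Proof. by rewrite (nth_map i) ?size_enum_ord// nth_ord_enum. Qed.

Lemma sum_abs_seq (g : R -> R) : \sum_(i < n) g `|x ord0 i| = \sum_(t <- v) g t.
Proof. by rewrite /v /abs_seq big_map big_enum. Qed.

Lemma sum_sorted (g : R -> R) : \sum_(t <- v) g t = \sum_(0 <= q < n) g (y q.+1).
Proof.
rewrite (perm_big s) /=; last by rewrite perm_sym perm_sort.
by rewrite (big_nth 0) size_s.
Qed.

(** The sum over all ordered pairs is invariant under sorting; by symmetry and the zero diagonal it
    is twice either side. *)
Lemma sum_pairs_sorted (G : R -> R -> R) :
  (forall t u, G t u = G u t) -> (forall t, G t t = 0) ->
  \sum_(i < n) \sum_(j < n | (i < j)%N) G `|x ord0 i| `|x ord0 j| =
  \sum_(0 <= q < n) \sum_(1 <= p < q.+1) G (y q.+1) (y p).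
Proof.
move=> Gsym G0; apply: (mulfI (x := 2)) => //.
have -> : 2 * (\sum_(i < n) \sum_(j < n | (i < j)%N) G `|x ord0 i| `|x ord0 j|) =
    \sum_(t <- v) \sum_(u <- v) G t u.
  under eq_bigr do under eq_bigr do rewrite -!nth_abs_seq.
  rewrite -(sum_ord_pairs n (fun i j => G (nth 0 v i) (nth 0 v j)))//.
  rewrite -(sum_abs_seq (fun t => \sum_(u <- v) G t u)); apply: eq_bigr => i _.
  rewrite -nth_abs_seq -(sum_abs_seq (G (nth 0 v i))); apply: eq_bigr => j _.
  by rewrite !nth_abs_seq.
rewrite (sum_sorted (fun t => \sum_(u <- v) G t u)) big_mkord.
rewrite (eq_bigr (fun i : 'I_n => \sum_(j < n) G (y i.+1) (y j.+1))); last first.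
  by move=> i _; rewrite (sum_sorted (G (y i.+1))) big_mkord.
rewrite (sum_ord_pairs n (fun i j => G (y i.+1) (y j.+1)))//; congr (_ * _).
rewrite (exchange_big_dep xpredT) //= big_mkord; apply: eq_bigr => q _.
rewrite big_add1 /= (big_nat_widen _ _ n) 1?ltnW// big_mkord /=.
by apply: eq_bigr => p _; exact: Gsym.
Qed.

Hypotheses (uv : uniq v) (v0 : all (> 0) v).

Lemma sorted_path : path <%R 0 s.
Proof.
rewrite path_min_sorted; first by rewrite sort_lt_sorted.
by rewrite all_sort.
Qed.

Lemma sorted_lt l : (l < n)%N -> y l < y l.+1.
Proof. by move=> ln; apply: (pathP 0 sorted_path); rewrite size_s. Qed.

Lemma abs_seq_neq i j : i != j -> `|x ord0 i| != `|x ord0 j|.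
Proof.
apply: contra_neq => ij; apply: val_inj; apply/eqP.
have := @nth_uniq _ 0 v i j; rewrite size_abs_seq.
move=> /(_ (ltn_ord i) (ltn_ord j) uv) <-.
by rewrite !nth_abs_seq ij.
Qed.

Lemma abs_seq_gt0 i : 0 < `|x ord0 i|.
Proof. by apply: (allP v0); apply/map_f; rewrite mem_enum. Qed.

Lemma denominatorE (r a : R) :
  ((\prod_(i < n) \prod_(j < n | (i < j)%N)
      `|x ord0 i ^+ 2 - x ord0 j ^+ 2| `^ (1 / r)) *
   (\prod_(i < n) `|x ord0 i| `^ (1 / 2 - a / r))) ^+ 2 =
  expR (\sum_(0 <= q < n) ((1 - 2 * a / r) * ln (y q.+1)
    + 2 / r * \sum_(1 <= p < q.+1) ln (y q.+1 ^+ 2 - y p ^+ 2))).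
Proof.
(* As ln 0 = 0, this vanishes on the diagonal, as [sum_pairs_sorted] requires. *)
pose G t u : R := ln `|t ^+ 2 - u ^+ 2|.
have Gsym t u : G t u = G u t by rewrite /G distrC.
have G0 t : G t t = 0 by rewrite /G subrr normr0 ln0.
have -> : \prod_(i < n) \prod_(j < n | (i < j)%N)
      `|x ord0 i ^+ 2 - x ord0 j ^+ 2| `^ (1 / r) =
   expR (\sum_(i < n) \sum_(j < n | (i < j)%N) r^-1 * G `|x ord0 i| `|x ord0 j|).
  rewrite expR_sum; apply: eq_bigr => i _; rewrite expR_sum; apply: eq_bigr => j ij.
  rewrite /powR div1r /G !real_normK ?num_real// ifF//.
  apply/negbTE; rewrite normr_eq0 subr_eq0 -(real_normK (num_real (x ord0 i))).
  rewrite -(real_normK (num_real (x ord0 j))) eqrXn2// abs_seq_neq//.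
  by rewrite -val_eqE /= (ltn_eqF ij).
have -> : \prod_(i < n) `|x ord0 i| `^ (1 / 2 - a / r) =
    expR (\sum_(i < n) (1 / 2 - a / r) * ln `|x ord0 i|).
  rewrite expR_sum; apply: eq_bigr => i _.
  by rewrite /powR gt_eqF// abs_seq_gt0.
rewrite -expRD -expRM_natl; congr expR.
under eq_bigr do rewrite -mulr_sumr.
rewrite -mulr_sumr sum_pairs_sorted// -mulr_sumr.
rewrite (sum_abs_seq (@ln R)) sum_sorted big_split /= -!mulr_sumr.
have -> : \sum_(0 <= q < n) \sum_(1 <= p < q.+1) G (y q.+1) (y p) =
    \sum_(0 <= q < n) \sum_(1 <= p < q.+1) ln (y q.+1 ^+ 2 - y p ^+ 2).
  apply: eq_big_nat => q /andP[_ qn]; apply: eq_big_nat => p /andP[p1 pq].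
  rewrite /G ger0_norm// subr_ge0.
  have yi l : (0 <= l < n)%N -> y l < y l.+1 by case/andP => _; exact: sorted_lt.
  have mono := mono_seq y 0 n yi.
  have yp0 : 0 <= y p by have := mono 0%N p; apply => //; move: pq qn; clear; lia.
  have ypq : y p <= y q.+1 by apply: mono; move: pq qn; clear; lia.
  by rewrite lerXn2r ?nnegrE// (le_trans yp0).
by set ri := r^-1; field.
Qed.

End sorted_coordinates.

Section pointwise_bound.
Context {R : realType} {N : nat}.
Implicit Types f : {mpoly R[i][N.+1]}.

Lemma weight_itv (m : multinom N.+1) (a b : nat) : (b <= N.+1)%N ->
  weight [set l : 'I_N.+1 | (a <= l < b)%N]%SET m = (\sum_(a <= l < b) m (inord l))%N.
Proof.
move=> bN; rewrite (big_nat_widen _ _ N.+1)//= (big_nat_widenl _ 0%N)//= big_mkord /weight.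
apply: eq_big => i; first by rewrite inE andbC.
by rewrite inord_val.
Qed.

Lemma normc_real (a : R) : Normc.normc a%:C = `|a|.
Proof. by rewrite /Normc.normc /= expr0n addr0 sqrtr_sqr. Qed.

Lemma normc_ge0 (z : R[i]) : 0 <= Normc.normc z.
Proof. by case: z => a b; exact: sqrtr_ge0. Qed.

Lemma normc_sum (I : Type) (t : seq I) (F : I -> R[i]) :
  Normc.normc (\sum_(i <- t) F i) <= \sum_(i <- t) Normc.normc (F i).
Proof.
elim/big_ind2: _ => //.
  by rewrite [X in X <= _]Normc.normc0.
move=> a1 z1 a2 z2 h1 h2.
have /le_trans : Normc.normc (z1 + z2) <= Normc.normc z1 + Normc.normc z2.
  exact: le_normcD.
by apply; exact: lerD.
Qed.

Lemma normc_meval_real f (d : 'I_N.+1 -> R) : (forall l, 0 <= d l) ->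
  Normc.normc (meval (fun l => (d l)%:C) f) <=
  \sum_(m <- msupp f) Normc.normc (mcoeff m f) * \prod_l d l ^+ m l.
Proof.
move=> d0; rewrite mevalE; apply: (le_trans (normc_sum _ _ _)).
apply: ler_sum => m _; rewrite Normc.normcM.
under eq_bigr do rewrite -rmorphXn.
rewrite -rmorph_prod normc_real ger0_norm//.
by apply: prodr_ge0 => l _; exact: exprn_ge0.
Qed.

Variables (f : {mpoly R[i][N.+1]}) (r s eps M : R).
Hypotheses (eps1 : eps <= 1) (M0 : 0 < M).
Hypothesis origin_run : forall pos e m b, injective pos ->
  m \in msupp (gap_mpoly pos e f) -> (b <= N.+1)%N ->
  eps * b%:R <= 2 * (weight [set l : 'I_N.+1 | (0 <= l < b)%N]%SET m)%:R
                + 2 * s / r * b%:R - 2 / r * b%:R * (b%:R - 1).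
Hypothesis other_run : forall pos e m a b, injective pos ->
  m \in msupp (gap_mpoly pos e f) -> (0 < a <= b)%N -> (b <= N.+1)%N ->
  eps * (b - a)%:R <= 2 * (weight [set l : 'I_N.+1 | (a <= l < b)%N]%SET m)%:R
                + (b - a)%:R - r^-1 * (b - a)%:R * ((b - a)%:R + 1).

(** A generic x lies in one of finitely many chambers, given by order and signs. There f is a finite
    sum of monomials in the gaps, each bounded by [log_weight_bound]. *)
Lemma g_fun_le_gap_prod : exists C : R, 0 <= C /\
  forall x : 'rV[R]_N.+1, (forall i, `|x ord0 i| <= M) ->
  uniq (abs_seq N.+1 x) -> all (> 0) (abs_seq N.+1 x) ->
  Normc.normc (g_fun f r s x) ^+ 2 <=
    C * gap_prod (eps - 1) 0 (sort <=%R (abs_seq N.+1 x)).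
Proof.
pose posT : Type := {ffun 'I_N.+1 -> 'I_N.+1}.
pose eT : Type := {ffun 'I_N.+1 -> bool}.
have /choice[K KP] : forall t : posT * eT * multinom N.+1, exists K : R,
    injective t.1.1 -> t.2 \in msupp (gap_mpoly t.1.1 t.1.2 f) ->
    forall y : nat -> R, y 0%N = 0 ->
    (forall l, (l < N.+1)%N -> y l < y l.+1) -> y N.+1 <= M ->
    \sum_(0 <= q < N.+1) (2 * (t.2 (inord q))%:R * ln (y q.+1 - y q)
      - (1 - 2 * s / r) * ln (y q.+1)
      - 2 / r * \sum_(1 <= p < q.+1) ln (y q.+1 ^+ 2 - y p ^+ 2)) <=
    K + (eps - 1) * \sum_(0 <= l < N.+1) ln (y l.+1 - y l).
  move=> [[pos e] m] /=.
  (* Triples that do not come from an order and an occurring monomial get the dummy constant 0. *)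
  have [[pinj mf]|H] := pselect (injective pos /\ m \in msupp (gap_mpoly pos e f)); last first.
    by exists 0 => pinj mf; case: H.
  have [||K KP] := log_weight_bound r s eps M N.+1 (fun l => m (inord l)) eps1 M0.
  - by move=> b bN; rewrite -weight_itv//; exact: origin_run pinj mf bN.
  - by move=> a b ab bN; rewrite -weight_itv//; exact: other_run pinj mf ab bN.
  by exists K => _ _.
(* K bounds the logarithm of a square, hence the half. *)
pose C0 (t : posT * eT) : R := \sum_(m <- msupp (gap_mpoly t.1 t.2 f))
   Normc.normc (mcoeff m (gap_mpoly t.1 t.2 f)) * expR (K (t, m) / 2).
have C00 t : 0 <= C0 t.
  by apply: sumr_ge0 => m _; rewrite mulr_ge0 ?normc_ge0 ?expR_ge0.
(* The sum over all orders and signs makes the constant independent of x. *)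
exists (\sum_(t : {ffun 'I_N.+1 -> 'I_N.+1} * {ffun 'I_N.+1 -> bool}) C0 t ^+ 2).
split; first by apply: sumr_ge0 => t _; exact: sqr_ge0.
move=> x xM uv v0.
set v := abs_seq N.+1 x in uv v0 *; set S := sort <=%R v.
pose y := nth 0 (0 :: S).
have szS : size S = N.+1 by rewrite size_sort size_abs_seq.
have vS i : `|x ord0 i| \in S.
  by rewrite mem_sort; apply/map_f; rewrite mem_enum.
pose pos : {ffun 'I_N.+1 -> 'I_N.+1} := [ffun i => inord (index `|x ord0 i| S)].
pose e : {ffun 'I_N.+1 -> bool} := [ffun i => x ord0 i < 0].
have posE i : y (pos i).+1 = `|x ord0 i|.
  have iS : (index `|x ord0 i|%R S < N.+1)%N by move: (vS i); rewrite -index_mem szS.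
  by rewrite /pos ffunE inordK// /y /= nth_index.
have pos_inj : injective pos.
  move=> i j ij; apply/eqP/negPn/negP => /(abs_seq_neq _ _ uv).
  by rewrite -!posE ij eqxx.
have ylt := sorted_lt _ _ uv v0.
have yM : y N.+1 <= M.
  have : y N.+1 \in S by apply/(nthP 0); exists N; rewrite ?szS.
  by rewrite mem_sort => /seq.mapP[i _ ->].
pose d (l : 'I_N.+1) := y l.+1 - y l.
have d0 l : 0 < d l by rewrite subr_gt0; exact: ylt.
have fE : meval (fun i => (x ord0 i)%:C) f =
    meval (fun l => (d l)%:C) (gap_mpoly pos e f).
  rewrite meval_gap_mpoly; apply: meval_eq => i; rewrite /gap_point.
  have cumE k : (k <= N.+1)%N -> cum (fun l => (d l)%:C) k = (y k)%:C.
    elim: k => [|k IH] kN; first by rewrite cum0.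
    rewrite cumS// IH 1?ltnW// /d inordK// -rmorphD /=.
    by rewrite addrC subrK.
  rewrite cumE// posE ffunE [in LHS](numEsign (x ord0 i)) rmorphM.
  by rewrite rmorph_sign.
set den := ((\prod_(i < N.+1) \prod_(j < N.+1 | (i < j)%N)
       `|x ord0 i ^+ 2 - x ord0 j ^+ 2| `^ (1 / r)) *
   (\prod_(i < N.+1) `|x ord0 i| `^ (1 / 2 - s / r))).
have den0 : 0 <= den.
  apply: mulr_ge0; apply: prodr_ge0 => i _; last exact: powR_ge0.
  by apply: prodr_ge0 => j _; exact: powR_ge0.
have denE := denominatorE _ _ uv v0 r s; rewrite -/den -/v -/S -/y in denE.
have den_gt0 : 0 < den.
  rewrite lt_neqAle den0 andbT; apply/eqP => den_eq0.
  have := expR_gt0 (\sum_(0 <= q < N.+1) ((1 - 2 * s / r) * ln (y q.+1)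
    + 2 / r * \sum_(1 <= p < q.+1) ln (y q.+1 ^+ 2 - y p ^+ 2))).
  by rewrite -denE -den_eq0 expr0n ltxx.
set L := \sum_(0 <= l < N.+1) ln (y l.+1 - y l).
have mono_le m : m \in msupp (gap_mpoly pos e f) ->
    \prod_l d l ^+ m l / den <= expR (K ((pos, e), m) / 2) * expR ((eps - 1) * L / 2).
  move=> mf; have P0 : 0 <= \prod_l d l ^+ m l.
    by apply: prodr_ge0 => l _; rewrite exprn_ge0 ?(ltW (d0 l)).
  rewrite -(@ler_pXn2r _ 2)// ?nnegrE ?mulr_ge0 ?expR_ge0 ?invr_ge0//.
  have -> : \prod_l d l ^+ m l =
      expR (\sum_(0 <= q < N.+1) (m (inord q))%:R * ln (y q.+1 - y q)).
    rewrite big_mkord expR_sum; apply: eq_bigr => l _.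
    by rewrite inord_val expRM_natl lnK// posrE; exact: d0.
  rewrite exprMn exprVn denE -expRM_natl -expRN -expRD -expRD -expRM_natl ler_expR.
  have := KP ((pos, e), m) pos_inj mf y erefl ylt yM.
  rewrite -/L; set T := \sum_(0 <= q < N.+1) _ => H.
  have -> : 2%:R * (\sum_(0 <= q < N.+1) (m (inord q))%:R * ln (y q.+1 - y q)) -
      \sum_(0 <= q < N.+1) ((1 - 2 * s / r) * ln (y q.+1)
        + 2 / r * \sum_(1 <= p < q.+1) ln (y q.+1 ^+ 2 - y p ^+ 2)) = T.
    by rewrite mulr_sumr -sumrB; apply: eq_bigr => q _; ring.
  by move: H; clear; lra.
rewrite /g_fun fE Normc.normcM Normc.normcV normc_real ger0_norm// -/den.
have gL : Normc.normc (meval (fun l => (d l)%:C) (gap_mpoly pos e f)) / den <=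
    C0 (pos, e) * expR ((eps - 1) * L / 2).
  apply: (@le_trans _ _ (\sum_(m <- msupp (gap_mpoly pos e f))
     Normc.normc (mcoeff m (gap_mpoly pos e f)) * \prod_l d l ^+ m l / den)).
    rewrite -mulr_suml ler_wpM2r ?invr_ge0// normc_meval_real// => l.
    exact/ltW.
  rewrite /C0 mulr_suml big_seq [leRHS]big_seq; apply: ler_sum => m mf.
  rewrite -mulrA -[leRHS]mulrA; apply: ler_wpM2l; first exact: normc_ge0.
  exact: mono_le.
apply: (@le_trans _ _ (C0 (pos, e) ^+ 2 * gap_prod (eps - 1) 0 S)).
  rewrite gap_prodE ?sorted_path// szS -/L.
  have -> : expR ((eps - 1) * L) = expR ((eps - 1) * L / 2) ^+ 2.
    by rewrite -expRM_natl; congr expR; field.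
  rewrite -exprMn ler_pXn2r// nnegrE.
    by rewrite divr_ge0 ?normc_ge0.
  by rewrite mulr_ge0 ?expR_ge0.
rewrite ler_wpM2r ?gap_prod_ge0// (bigD1 (pos, e))//= lerDl.
by apply: sumr_ge0 => t _; exact: sqr_ge0.
Qed.

End pointwise_bound.

(** * Local integrability *)

Section degenerate.
Local Open Scope ereal_scope.
Context {R : realType}.

(** The term of index 0 is the indicator of [-M, M]. *)
Lemma dyadic_kernel_ge1 (M eps t : R) : (eps <= 1)%R -> (`|t| <= M)%R ->
  1 <= dyadic_kernel M eps t.
Proof.
move=> eps1 tM.
have q1 : (1 <= 2 `^ (1 - eps) :> R)%R.
  by rewrite -[leLHS](powRr0 2) ler_powR ?ler1n ?subr_ge0.
have term0 k : 0 <= (((2 `^ (1 - eps)) ^+ k) * \1_(dyadic_ball M k) t)%:E.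
  by rewrite lee_fin mulr_ge0 ?exprn_ge0 ?powR_ge0.
apply: (@le_trans _ _ (\sum_(0 <= k < 1)
  (((2 `^ (1 - eps)) ^+ k) * \1_(dyadic_ball M k) t)%:E)).
  rewrite big_nat1 expr0 mul1r indicE mem_set//.
  by rewrite /dyadic_ball/= expr0 divr1.
by apply: nneseries_lim_ge => k _ _; exact: term0.
Qed.

Variables (kap : R -> \bar R) (M : R).
Hypotheses (kap_ge0 : forall t, 0 <= kap t) (kap0 : kap 0%R = +oo).
Hypothesis kap_ge1 : forall t, (`|t| <= M)%R -> 1 <= kap t.

Let kap_le_sum z w (u : seq R) : w \in u -> kap (z - w)%R <= \sum_(w <- u) kap (z - w)%R.
Proof. by move=> wu; rewrite (big_rem w)//= leeDl// sume_ge0. Qed.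

Let sum_ge1 z (v : seq R) : (`|z| <= M)%R -> 1 <= \sum_(w <- 0%R :: v) kap (z - w)%R.
Proof.
move=> zM; apply: (le_trans _ (kap_le_sum z 0%R _ (mem_head _ _))).
by rewrite subr0; exact: kap_ge1.
Qed.

Lemma tree_sum_ge1 (v : seq R) : (forall z, z \in v -> `|z| <= M)%R -> 1 <= tree_sum kap v.
Proof.
elim: v => //= z v IH vM; rewrite -[X in X <= _]mule1; apply: lee_pmul => //.
  by apply: sum_ge1; apply: vM; rewrite mem_head.
by apply: IH => w wv; apply: vM; rewrite inE wv orbT.
Qed.

(** A repeated or zero entry brings in kap 0 = +oo. The remaining factors are at least 1, which
    excludes the conventional value 0 * +oo = 0. *)
Lemma tree_sum_degenerate (v : seq R) :
  (forall z, z \in v -> 0 <= z <= M)%R ->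
  ~~ (uniq v && all (> 0)%R v) -> tree_sum kap v = +oo.
Proof.
elim: v => //= z v IH vM H.
have vM' w : w \in v -> (0 <= w <= M)%R by move=> wv; apply: vM; rewrite inE wv orbT.
have normM w : w \in z :: v -> (`|w| <= M)%R.
  by move=> /vM /andP[w0 wM]; rewrite ger0_norm.
have ts1 : 1 <= tree_sum kap v.
  by apply: tree_sum_ge1 => w wv; apply: normM; rewrite inE wv orbT.
have ts0 : 0 < tree_sum kap v by exact: lt_le_trans ts1.
have [zv|zv] := boolP (z \in 0%R :: v).
  have /eqP -> : \sum_(w <- 0%R :: v) kap (z - w)%R == +oo.
    by have := kap_le_sum z z _ zv; rewrite subrr kap0 leye_eq.
  by rewrite gt0_mulye.
move: zv; rewrite inE negb_or => /andP[z0 zv].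
rewrite IH//; last first.
  apply: contra H => /andP[-> ->]; rewrite zv !andbT/= lt_neqAle eq_sym z0/=.
  by case/andP: (vM z (mem_head _ _)).
rewrite gt0_muley//; apply: lt_le_trans (sum_ge1 z v _) => //.
by apply: normM; rewrite mem_head.
Qed.

End degenerate.

Section locally_L2.
Context {R : realType} {N : nat}.
Variables (f : {mpoly R[i][N.+1]}) (r s : R).

Lemma sqr_normc (z : R[i]) :
  Normc.normc z ^+ 2 = complex.Re z ^+ 2 + complex.Im z ^+ 2.
Proof. by case: z => a b; rewrite /Normc.normc sqr_sqrtr// addr_ge0 ?sqr_ge0. Qed.

(** At real points the real and imaginary parts of f are the polynomials with the real and imaginary
    parts of its coefficients. *)
Lemma measurable_sqr_normc_g_fun :
  measurable_fun setT (fun x : 'rV[R]_N.+1 => Normc.normc (g_fun f r s x) ^+ 2).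
Proof.
have mc i : measurable_fun setT (fun x : 'rV[R]_N.+1 => x ord0 i).
  exact: measurable_rV_coord.
have mpow (h : 'rV[R]_N.+1 -> R) a : measurable_fun setT h ->
    measurable_fun setT (fun x => h x `^ a).
  by move=> mh; exact: (measurableT_comp (measurable_powR a) mh).
pose den (x : 'rV[R]_N.+1) := (\prod_(i < N.+1) \prod_(j < N.+1 | (i < j)%N)
       `|x ord0 i ^+ 2 - x ord0 j ^+ 2| `^ (1 / r)) *
   (\prod_(i < N.+1) `|x ord0 i| `^ (1 / 2 - s / r)).
pose P (h : R[i] -> R) (x : 'rV[R]_N.+1) :=
  \sum_(m <- msupp f) h (mcoeff m f) * \prod_i x ord0 i ^+ m i.
have evalE (x : 'rV[R]_N.+1) : meval (fun i => (x ord0 i)%:C) f =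
    \sum_(m <- msupp f) mcoeff m f * (\prod_i x ord0 i ^+ m i)%:C.
  rewrite mevalE; apply: eq_bigr => m _; rewrite rmorph_prod; congr (_ * _).
  by apply: eq_bigr => i _; rewrite rmorphXn.
have ReE (x : 'rV[R]_N.+1) : complex.Re (meval (fun i => (x ord0 i)%:C) f) =
    P (@complex.Re R) x.
  rewrite evalE /P (big_morph (@complex.Re R) (id1 := 0) (op1 := +%R))//;
    last by case=> ? ? [].
  by apply: eq_bigr => m _; case: (mcoeff m f) => a b /=; rewrite mulr0 subr0.
have ImE (x : 'rV[R]_N.+1) : complex.Im (meval (fun i => (x ord0 i)%:C) f) =
    P (@complex.Im R) x.
  rewrite evalE /P (big_morph (@complex.Im R) (id1 := 0) (op1 := +%R))//;
    last by case=> ? ? [].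
  by apply: eq_bigr => m _; case: (mcoeff m f) => a b /=; rewrite mulr0 add0r.
have mP h : measurable_fun setT (P h).
  apply: measurable_sum => m; apply: measurable_funM => //.
  by apply: measurable_prod => i _; exact: measurable_funX.
have mden : measurable_fun setT den.
  apply: measurable_funM; apply: measurable_prod => i _.
    under eq_fun do rewrite big_mkcond.
    apply: measurable_prod => j _; case: (boolP (i < j)%N) => _ /=; last exact: measurable_cst.
    apply: mpow; apply: measurableT_comp => //.
    by apply: measurable_funB; exact: measurable_funX.
  by apply: mpow; exact: measurableT_comp.
have den0 x : 0 <= den x.
  apply: mulr_ge0; apply: prodr_ge0 => i _; last exact: powR_ge0.
  by apply: prodr_ge0 => j _; exact: powR_ge0.
(* The denominator is nonnegative, so its inverse is the real power of exponent -1, even at 0. *)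
rewrite (_ : (fun x => _) = fun x =>
  (P (@complex.Re R) x ^+ 2 + P (@complex.Im R) x ^+ 2) * (den x `^ (- 1)) ^+ 2).
  apply: measurable_funM; last first.
    by apply: measurable_funX; exact: mpow.
  by apply: measurable_funD; exact: measurable_funX.
apply/funext => x; rewrite /g_fun Normc.normcM Normc.normcV normc_real -/(den x).
by rewrite exprMn sqr_normc ReE ImE ger0_norm// powR_inv1.
Qed.

Lemma locally_L2_g_fun (eps : R) : 0 < eps -> eps <= 1 ->
  (forall pos e m b, injective pos ->
    m \in msupp (gap_mpoly pos e f) -> (b <= N.+1)%N ->
    eps * b%:R <= 2 * (weight [set l : 'I_N.+1 | (0 <= l < b)%N]%SET m)%:R
                + 2 * s / r * b%:R - 2 / r * b%:R * (b%:R - 1)) ->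
  (forall pos e m a b, injective pos ->
    m \in msupp (gap_mpoly pos e f) -> (0 < a <= b)%N -> (b <= N.+1)%N ->
    eps * (b - a)%:R <= 2 * (weight [set l : 'I_N.+1 | (a <= l < b)%N]%SET m)%:R
                + (b - a)%:R - r^-1 * (b - a)%:R * ((b - a)%:R + 1)) ->
  locally_L2 (g_fun f r s).
Proof.
move=> eps0 eps1 origin_run other_run x0.
(* M bounds every |x_i| on the unit ball around x0, hence also the distances between these absolute
   values. *)
pose M : R := 1 + \sum_i `|x0 ord0 i|.
have M0 : 0 < M by rewrite ltr_pwDl// sumr_ge0.
have [C [C0 CP]] := g_fun_le_gap_prod f r s eps M eps1 M0 origin_run other_run.
pose kap := dyadic_kernel M eps.
have kap_ge0 t : (0 <= kap t)%E by exact: dyadic_kernel_ge0.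
pose c := M `^ (eps - 1) * 2 `^ (1 - eps).
have c0 : 0 <= c by rewrite mulr_ge0 ?powR_ge0.
pose D := (2 `^ (- (eps - 1)) * c) ^+ N.+1.
have D0 : 0 <= D by rewrite exprn_ge0 ?mulr_ge0 ?powR_ge0.
have bound x : ball x0 1 x ->
    ((Normc.normc (g_fun f r s x) ^+ 2)%:E <=
     (C * D + 1)%:E * tree_sum kap (abs_seq N.+1 x))%E.
  move=> xU.
  have xM i : `|x ord0 i| <= M.
    have /= h : ball (x0 ord0 i) 1 (x ord0 i) by case: xU => _; exact.
    rewrite /ball/= in h.
    rewrite -(subrK (x0 ord0 i) (x ord0 i)) (le_trans (ler_normD _ _))// /M.
    apply: lerD; first by rewrite distrC ltW.
    by rewrite (bigD1 i)//= lerDl sumr_ge0.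
  have vM z : z \in abs_seq N.+1 x -> (0 <= z <= M).
    by move=> /seq.mapP[i _ ->]; rewrite normr_ge0 xM.
  have [/andP[uv v0]|deg] :=
      boolP (uniq (abs_seq N.+1 x) && all (> 0) (abs_seq N.+1 x)); last first.
    (* At a zero coordinate or two equal absolute values the tree sum is +oo; the + 1 keeps its
       coefficient positive, so the bound is trivial there. *)
    rewrite (tree_sum_degenerate kap M)//.
    - by rewrite gt0_muley ?leey// lte_fin ltr_wpDl// mulr_ge0.
    - exact: dyadic_kernel0.
    - by move=> t; exact: dyadic_kernel_ge1.
  apply: (@le_trans _ _ ((C * D)%:E * tree_sum kap (abs_seq N.+1 x))%E); last first.
    by apply: lee_wpmul2r; [exact: tree_sum_ge0|rewrite lee_fin lerDl].
  apply: (@le_trans _ _ (C * gap_prod (eps - 1) 0 (sort <=%R (abs_seq N.+1 x)))%:E).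
    by rewrite lee_fin; exact: CP.
  rewrite !EFinM -muleA; apply: lee_wpmul2l; first by rewrite lee_fin.
  rewrite /D -[X in _ ^+ X](size_abs_seq _ x).
  apply: gap_prod_le_tree_sum => //; first by rewrite subr_le0.
    by move=> t tM; have := powR_le_dyadic_kernel M eps M0 eps1 t tM; apply.
  by move=> z zv; rewrite (allP v0 z zv)/=; case/andP: (vM z zv).
exists (ball x0 1); split; [exact: ball_open|exact: ballxx|].
have mU : measurable (ball x0 1 : set 'rV[R]_N.+1).
  by apply: open_measurable_rV; exact: ball_open.
have mk : measurable_fun setT kap by exact: measurable_dyadic_kernel.
have mt : measurable_fun setT (fun x : 'rV[R]_N.+1 => tree_sum kap (abs_seq N.+1 x)).
  exact: measurable_tree_sum_abs_seq.
apply/integrableP; split.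
  apply/measurable_EFinP; apply: (measurable_funS measurableT) => //.
  exact: measurable_sqr_normc_g_fun.
apply: (@le_lt_trans _ _ (\int[lebesgue_rV R N.+1]_(x in ball x0 1)
   ((C * D + 1)%:E * tree_sum kap (abs_seq N.+1 x)))%E).
  apply: ge0_le_integral => //.
  - apply: measurableT_comp => //; apply/measurable_EFinP.
    apply: (measurable_funS measurableT) => //.
    exact: measurable_sqr_normc_g_fun.
  - by apply: (measurable_funS measurableT) => //; exact: measurable_funeM.
  - move=> x xU; rewrite abse_EFin ger0_norm ?sqr_ge0//; exact: bound.
apply: (@le_lt_trans _ _ (\int[lebesgue_rV R N.+1]_x
   ((C * D + 1)%:E * tree_sum kap (abs_seq N.+1 x)))%E).
  apply: ge0_subset_integral => //.
    exact: measurable_funeM.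
  by move=> x _; rewrite mule_ge0 ?tree_sum_ge0// lee_fin addr_ge0 ?mulr_ge0.
rewrite ge0_integralZl_EFin//; last 2 first.
- by move=> x _; exact: tree_sum_ge0.
- by rewrite addr_ge0 ?mulr_ge0.
rewrite lte_mul_pinfty// ?lee_fin ?addr_ge0 ?mulr_ge0//.
have q2 : 0 <= 4 * M / (1 - 2 `^ (1 - eps) / 2).
  rewrite divr_ge0 ?mulr_ge0 ?(ltW M0)// subr_ge0 ler_pdivrMr// mul1r.
  by rewrite -[leRHS]powRr1// ler_powR ?ler1n// gerBl ltW.
apply: (integral_tree_sum kap _ q2) => // w.
exact: integral_dyadic_kernel.
Qed.

End locally_L2.

(** * The choice of eps under each of the four sets of conditions *)

Section cases.
Context {R : realType} {N : nat}.
Variables (f : {mpoly R[i][N.+1]}) (r s : R).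

Let eps_itv (a : R) : 0 < a -> 0 < Num.min 1 a <= 1.
Proof. by move=> a0; rewrite lt_min ltr01 a0 ge_min lexx. Qed.

(** The difference of the two sides is at least 2 A + k (r - k - 2) / r with k <= N. So for r >= N +
    2, where N.+1 is the number of coordinates, clusters away from the origin need no vanishing of
    f. *)
Let other_run_large (m : multinom N.+1) (eps : R) a b :
  N%:R + 2 <= r -> eps <= r^-1 ->
  (0 < a <= b)%N -> (b <= N.+1)%N ->
  eps * (b - a)%:R <= 2 * (weight [set l : 'I_N.+1 | (a <= l < b)%N]%SET m)%:R
     + (b - a)%:R - r^-1 * (b - a)%:R * ((b - a)%:R + 1).
Proof.
move=> rN er /andP[a0 ab] bN; set A := (weight _ _)%:R; set k := (b - a)%:R.
have A0 : 0 <= A by rewrite ler0n.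
have k0 : 0 <= k by rewrite ler0n.
have kN : k <= N%:R by rewrite ler_nat; lia.
have N0 : 0 <= N%:R :> R by rewrite ler0n.
have r0 : 0 < r by lra.
apply: (@le_trans _ _ (r^-1 * k)); first by rewrite ler_wpM2r.
rewrite -subr_ge0.
have -> : 2 * A + k - r^-1 * k * (k + 1) - r^-1 * k = 2 * A + k * (r - k - 2) / r.
  by field; rewrite gt_eqF.
by rewrite addr_ge0 ?mulr_ge0 ?invr_ge0 ?(ltW r0)//; lra.
Qed.

Lemma locally_L2_Ipm k : r = k%:R -> (2 <= k <= N.+1)%N ->
  @ideal_Ipm R N.+1 k.-1 f -> r - 1 <= s -> locally_L2 (g_fun f r s).
Proof.
move=> rk /andP[k2 kN] fI rs; case: k => [//|c] in rk k2 kN fI *.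
rewrite /= in fI; have c0 : (0 < c)%N by [].
have cR : 1 <= c%:R :> R by rewrite ler1n.
have rE : r = c%:R + 1 by rewrite rk natr1.
have r0 : 0 < r by lra.
have cr : 1 <= c%:R * r by rewrite rE; nra.
have cr0 : 0 < c%:R * r by lra.
(* With c = r - 1, this eps leaves a loss of only x once the inequalities are multiplied by c r. *)
apply: (locally_L2_g_fun f r s (c%:R * r)^-1).
- by rewrite invr_gt0.
- by rewrite invf_le1.
- move=> pos e m b pinj mf bN; set w := weight _ _; set A := w%:R; set x := b%:R.
  have [b0|b0] := posnP b.
    by rewrite /x b0 !(mulr0, mul0r) subr0 addr0 mulr_ge0.
  have ob : (0 < b <= N.+1)%N by rewrite b0.
  have := order_Ipm pos e pinj f c m 0 b fI mf ob; rewrite subn0 -/w => /= H.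
  have {}H : x * x <= c%:R * A + c%:R * x.
    by rewrite -!natrM -natrD ler_nat; move: H; clear; nia.
  have x1 : 1 <= x by rewrite ler1n.
  rewrite -subr_ge0.
  (* The first two terms are nonnegative by H and by s >= r - 1, the rest because x >= 1. *)
  have -> : 2 * A + 2 * s / r * x - 2 / r * x * (x - 1) - (c%:R * r)^-1 * x =
     (2 * r * (c%:R * A + c%:R * x - x * x) + 2 * c%:R * x * (s - (r - 1))
       + 2 * x * x - x) / (c%:R * r).
    by rewrite rE; field; rewrite !gt_eqF//; lra.
  have h1 : 0 <= 2 * r * (c%:R * A + c%:R * x - x * x).
    by rewrite mulr_ge0 ?subr_ge0// mulr_ge0// ltW.
  have h2 : 0 <= 2 * c%:R * x * (s - (r - 1)) by rewrite mulr_ge0 ?subr_ge0// !mulr_ge0.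
  have h3 : x <= x * x by rewrite ler_peMr// (le_trans ler01).
  by rewrite divr_ge0 ?(ltW cr0)//; lra.
- move=> pos e m a b pinj mf /andP[a0]; rewrite leq_eqVlt => /predU1P[<-|ab] bN.
    by rewrite subnn !(mulr0, mul0r) subr0 addr0 mulr_ge0.
  set w := weight _ _; set A := w%:R; set x := (b - a)%:R.
  have abN : (a < b <= N.+1)%N by rewrite ab.
  have := order_Ipm pos e pinj f c m a b fI mf abN; rewrite gtn_eqF// -/w => H.
  have {}H : (x + 1) * (x + 1) <= 2 * (c%:R * A) + c%:R * (x + 1).
    rewrite /x /A natr1 -!natrM -natrD ler_nat.
    move: H; rewrite !mul1n (_ : b - a.-1 = (b - a).+1)%N//.
    by move: a0 ab; clear; lia.
  have A0 : 0 <= A by rewrite ler0n.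
  have x0 : 0 <= x by rewrite ler0n.
  rewrite -subr_ge0.
  have -> : 2 * A + x - r^-1 * x * (x + 1) - (c%:R * r)^-1 * x =
     (r * (2 * (c%:R * A)) + c%:R * x * (r - (x + 1)) - x) / (c%:R * r).
    by rewrite rE; field; rewrite !gt_eqF//; lra.
  rewrite divr_ge0 ?(ltW cr0)//.
  (* A cluster of at most c points has r - (x + 1) >= 1, and A >= 0 is enough; a larger one uses the
     order bound H. *)
  have [xc|xc] := leqP (b - a).+1 c.
    have {}xc : x + 1 <= c%:R by rewrite natr1 ler_nat.
    have h1 : 0 <= r * (2 * (c%:R * A)) by rewrite !mulr_ge0// ltW.
    have h2 : c%:R * x <= c%:R * x * (r - (x + 1)).
      by rewrite ler_peMr ?mulr_ge0//; lra.
    have h3 : x <= c%:R * x by rewrite ler_peMl.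
    lra.
  have {}xc : c%:R <= x by rewrite ler_nat.
  have h1 : r * ((x + 1) * (x + 1) - c%:R * (x + 1)) <= r * (2 * (c%:R * A)).
    by rewrite ler_wpM2l ?(ltW r0)// lerBlDr.
  have h2 : 0 <= (x - c%:R) * (x + 1) by rewrite mulr_ge0 ?subr_ge0// addr_ge0.
  have h3 : 0 <= (x - c%:R) * c%:R by rewrite mulr_ge0 ?subr_ge0.
  by move: h1 h2 h3 cR xc; rewrite rE; clear; nra.
Qed.

Lemma locally_L2_J k : s = k%:R -> @ideal_J R N.+1 k f -> N.+1%:R + 1 <= r ->
  locally_L2 (g_fun f r s).
Proof.
move=> sk fJ rN; have rN' : N%:R + 2 <= r by move: rN; rewrite -natr1; lra.
have N0 : 0 <= N%:R :> R by rewrite ler0n.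
have r0 : 0 < r by lra.
apply: (locally_L2_g_fun f r s r^-1).
- by rewrite invr_gt0.
- by rewrite invf_le1//; lra.
- move=> pos e m b pinj mf bN; set w := weight _ _; set A := w%:R; set x := b%:R.
  have [b0|b0] := posnP b.
    by rewrite /x b0 !(mulr0, mul0r) subr0 addr0 mulr_ge0.
  have ob : (0 < b <= N.+1)%N by rewrite b0.
  have := order_J pos e pinj f k m b fJ mf ob; rewrite -/w => H.
  have {}H : x <= A + s by rewrite sk -natrD ler_nat.
  have A0 : 0 <= A by rewrite ler0n.
  have x1 : 1 <= x by rewrite ler1n.
  have xr : x <= r.
    have : x <= N.+1%:R by rewrite ler_nat.
    lra.
  rewrite -subr_ge0.
  have -> : 2 * A + 2 * s / r * x - 2 / r * x * (x - 1) - r^-1 * x =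
     (2 * r * A - 2 * x * (x - s) + x) / r.
    by field; rewrite gt_eqF.
  rewrite divr_ge0 ?(ltW r0)//.
  (* Either x <= s and the left side is at most 0, or x <= r and x - s <= A are multiplied. *)
  have : x * (x - s) <= r * A.
    have [xs|xs] := leP x s; first by nra.
    apply: (@le_trans _ _ (r * (x - s))); first by rewrite ler_wpM2r// subr_ge0 ltW.
    by rewrite ler_wpM2l ?(ltW r0)//; lra.
  lra.
- by move=> pos e m a b pinj mf ab bN; exact: other_run_large.
Qed.

Lemma locally_L2_large : N.+1%:R - 1 < s -> N.+1%:R + 1 <= r ->
  locally_L2 (g_fun f r s).
Proof.
move=> sN rN; have rN' : N%:R + 2 <= r by move: rN; rewrite -natr1; lra.
have sN' : N%:R < s by move: sN; rewrite -natr1; lra.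
have N0 : 0 <= N%:R :> R by rewrite ler0n.
have r0 : 0 < r by lra.
have r1 : 1 <= r by lra.
have sN0 : 0 < 2 * (s - N%:R) by lra.
have /andP[e0 e1] := eps_itv _ sN0.
(* A cluster at the origin has x <= N + 1 points, so 2 (s - x + 1) is at least 2 (s - N), the margin
   available for eps. *)
set eps := Num.min 1 (2 * (s - N%:R)) in e0 e1.
have e2 : eps <= 2 * (s - N%:R) by rewrite ge_min lexx orbT.
apply: (locally_L2_g_fun f r s (eps / r)).
- by rewrite divr_gt0.
- by rewrite ler_pdivrMr// mul1r (le_trans e1).
- move=> pos e m b pinj mf bN; set A := (weight _ _)%:R; set x := b%:R.
  have A0 : 0 <= A by rewrite ler0n.
  have x0 : 0 <= x by rewrite ler0n.
  have xN : x <= N%:R + 1 by rewrite natr1 ler_nat.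
  rewrite -subr_ge0.
  have -> : 2 * A + 2 * s / r * x - 2 / r * x * (x - 1) - eps / r * x =
     2 * A + x * (2 * (s - x + 1) - eps) / r.
    by field; rewrite gt_eqF.
  by rewrite addr_ge0 ?mulr_ge0 ?invr_ge0 ?(ltW r0)//; lra.
- move=> pos e m a b pinj mf ab bN; apply: other_run_large => //.
  by rewrite ler_pdivrMr// mulVf ?gt_eqF.
Qed.

Lemma locally_L2_neg : r < 0 -> s < 0 -> locally_L2 (g_fun f r s).
Proof.
move=> r0 s0.
have sr : 0 < 2 * (s / r) by rewrite mulr_gt0// nmulr_rgt0// invr_lt0.
have ri : r^-1 < 0 by rewrite invr_lt0.
have /andP[e0 e1] := eps_itv _ sr.
(* For r < 0 the terms - 1 / r are favourable; the margin is 2 s / r > 0 at the origin and 1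
   elsewhere. *)
set eps := Num.min 1 _ in e0 e1.
have e2 : eps <= 2 * (s / r) by rewrite ge_min lexx orbT.
apply: (locally_L2_g_fun f r s eps) => //.
- move=> pos e m b pinj mf bN.
  have xx : 0 <= b%:R * (b%:R - 1) :> R.
    by case: b bN => [|b] _; rewrite ?mul0r// mulr_ge0// subr_ge0 ler1n.
  set A := (weight _ _)%:R; have A0 : 0 <= A by rewrite ler0n.
  have h1 := ler_wpM2r (ler0n R b) e2.
  have h2 : r^-1 * (b%:R * (b%:R - 1)) <= 0 by rewrite mulr_le0_ge0// ltW.
  move: h1 h2; rewrite -/eps; set x := b%:R; lra.
- move=> pos e m a b pinj mf ab bN; set A := (weight _ _)%:R; set x := (b - a)%:R.
  have A0 : 0 <= A by rewrite ler0n.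
  have x0 : 0 <= x by rewrite ler0n.
  have h1 := ler_wpM2r x0 e1.
  have h2 : r^-1 * (x * (x + 1)) <= 0.
    by apply: mulr_le0_ge0; [exact: ltW|rewrite mulr_ge0// addr_ge0].
  lra.
Qed.

End cases.

Theorem theorem5p13 (R : realType) (N : nat) (N_gt0 : (0 < N)%N)
    (f : {mpoly R[i][N]}) (r s : R) :
  [\/ exists k : nat, [/\ r = k%:R, (2 <= k <= N)%N, @ideal_Ipm R N k.-1 f
        & r - 1 <= s],
      exists k : nat, [/\ s = k%:R, (0 <= k <= N.-1)%N, @ideal_J R N k f
        & N%:R + 1 <= r],
      N%:R - 1 < s /\ N%:R + 1 <= r
    | r < 0 /\ s < 0] ->
  locally_L2 (g_fun f r s).
Proof.
case: N N_gt0 f => [//|N'] _ f.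
case=> [[k [rk kN fI rs]]|[k [sk _ fJ rN]]|[sN rN]|[r0 s0]].
- exact: locally_L2_Ipm rk kN fI rs.
- exact: locally_L2_J sk fJ rN.
- exact: locally_L2_large.
- exact: locally_L2_neg.
Qed.
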